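(* Let $0<p<1$ be a constant probability and $s\ge 3$ be an integer. Then, with high probability (i.e., with probability tending to $1$ as $n\to\infty$), \[ sat(G(n,p),K_s)=(1+o(1))\, n\log_{\frac{1}{1-p}} n . \]
   Context: $G(n,p)$ denotes the Erdős–Rényi random graph on vertex set $[n]=\{1,\dots,n\}$ in which each pair of vertices is an edge independently with probability $p$. For graphs $G$ and $F$, a subgraph $H\subseteq G$ is $F$-saturated in $G$ if $H$ contains no copy of $F$ but adding to $H$ any edge of $G$ not in $H$ creates a copy of $F$ (i.e., $H$ is a maximal $F$-free subgraph of $G$). $sat(G,F)$ is the minimum number of edges of an $F$-saturated graph in $G$. $K_s$ is the complete graph on $s$ vertices. The $o(1)$ term tends to $0$ as $n\to\infty$. *)

(* Defs.v *)
From HB Require Import structures.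
From mathcomp Require Import all_boot all_order all_algebra.
From mathcomp Require Import all_classical all_reals all_analysis.

Set Implicit Arguments.
Unset Strict Implicit.
Unset Printing Implicit Defensive.

Import Order.TTheory GRing.Theory Num.Theory.
Import numFieldNormedType.Exports.

Local Open Scope ring_scope.

Definition vpairs (T : finType) : {set {set T}} := [set e : {set T} | #|e| == 2%N].

Record sgraph (T : finType) := SGraph {
  edges : {set {set T}};
  _ : edges \subset vpairs T }.

HB.instance Definition _ (T : finType) := [isSub for @edges T].
HB.instance Definition _ (T : finType) := [Finite of sgraph T by <:].

(* Sets in [E] that are not unordered pairs are discarded. *)
Definition graph_of_edges (T : finType) (E : {set {set T}}) : sgraph T :=
  SGraph (subsetIr E (vpairs T)).

Definition complete_graph (s : nat) : sgraph 'I_s := graph_of_edges [set: {set 'I_s}].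

Definition add_edge (T : finType) (H : sgraph T) (e : {set T}) : sgraph T :=
  graph_of_edges (e |: edges H).

(* Copies need not be induced. *)
Definition has_copy (T U : finType) (H : sgraph T) (F : sgraph U) : bool :=
  [exists f : {ffun U -> T},
    injectiveb f && [forall e in edges F, f @: e \in edges H]].

Definition saturated_in (T U : finType) (G : sgraph T) (F : sgraph U)
    (H : sgraph T) : bool :=
  [&& edges H \subset edges G, ~~ has_copy H F &
      [forall e in edges G :\: edges H, has_copy (add_edge H e) F]].

(* The default value #|edges G| bounds the size of every saturated H, so this is
   the true minimum as soon as a saturated H exists; one does whenever F has an
   edge (take a maximal F-free subgraph of G). *)
Definition sat (T U : finType) (G : sgraph T) (F : sgraph U) : nat :=
  \big[minn/#|edges G|]_(H : sgraph T | saturated_in G F H) #|edges H|.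

Definition gnp_weight (R : realType) (n : nat) (p : R) (G : sgraph 'I_n) : R :=
  \prod_(e in vpairs 'I_n) (if e \in edges G then p else 1 - p).

Definition gnp_pr (R : realType) (n : nat) (p : R) (A : pred (sgraph 'I_n)) : R :=
  \sum_(G : sgraph 'I_n | A G) gnp_weight p G.

Definition logb (R : realType) (b x : R) : R := ln x / ln b.

(* Main.v *)
(* Write [q = 1 - p] and [L = log_{1/q} n].

   Lower bound. With high probability, for every vertex [v] and every set [S] of at most
   [(1 - e) L] vertices, many neighbours [u] of [v] have no neighbour in [S]. Let [H] be
   saturated and let [A] be the set of vertices of large degree in [H]. If a vertex [v]
   outside [A] had at most [(1 - e) L] neighbours in [A], then every such [u] (for [S] the
   set of these neighbours) would be adjacent to [v] in [H] or share with [v] a neighbour in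
   [H] outside [A]; that is possible for few [u] only. So [H] has at least
   [(n - |A|) (1 - e) L] edges between [A] and its complement.

   Upper bound. Put [t = s - 2] and fix a set [A1] of about [(1 + e) L / p] vertices carrying
   a [K_(t+1)]-free graph all of whose linear-sized subsets contain a [K_t]; it is the shadow
   of a linear triangle-free [t]-uniform hypergraph, built greedily with a potential
   function. Join [A1] to all other vertices. A typical vertex has about [(1 + e) L]
   neighbours in [A1], and then shares linearly many of them with every other vertex, up to
   [O(1)] exceptions on average. The [o(n)] atypical vertices are joined to a second
   family of [O(log n)] disjoint [t]-sets, which takes care of the pairs of atypical vertices.
   The edges between this family and the typical vertices are taken care of by a third family
   of boundedly many [t]-sets. These parts form a blow-up of a 5-cycle, so no [K_s] arises,
   and completing this graph to a maximal [K_s]-free subgraph adds [o(n log n)] edges. *)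
Require Import Defs.
From mathcomp Require Import all_boot all_order all_algebra.
From mathcomp Require Import all_classical all_reals all_analysis.
From mathcomp Require Import fintype finset ring lra zify.
Import Order.TTheory GRing.Theory Num.Theory.
Import numFieldNormedType.Exports.
Set Implicit Arguments.
Unset Strict Implicit.
Unset Printing Implicit Defensive.
Local Open Scope ring_scope.

(** * Random subsets *)

Section RandomSubset.
Variables (R : realType) (T : finType) (p : R).
Implicit Types (Z D : {set T}) (f g : {set T} -> R) (A : pred {set T}).

(** Product measure on the subsets of [T]. Random graphs are obtained by sampling among all sets of
    vertices; [graph_of_edges] discards the sets that are not pairs, which leaves the law of the
    pairs unchanged. *)
Definition rsw Z : R := \prod_e (if e \in Z then p else 1 - p).
Definition Ex f : R := \sum_Z rsw Z * f Z.
Definition Pr A : R := Ex (fun Z => (A Z)%:R).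

Lemma eq_Ex f g : f =1 g -> Ex f = Ex g.
Proof. by move=> fg; apply: eq_bigr => Z _; rewrite fg. Qed.

Lemma Ex_prodf (h : T -> bool -> R) :
  Ex (fun Z => \prod_e h e (e \in Z)) = \prod_e (p * h e true + (1 - p) * h e false).
Proof.
rewrite bigA_distr; apply: eq_bigr => Z _.
rewrite /rsw -big_split /=; apply: eq_bigr => e _.
by case: (e \in Z).
Qed.

Lemma sum_rsw : \sum_Z rsw Z = 1.
Proof.
have := Ex_prodf (fun _ _ => 1); rewrite [RHS]big1 => [|e _]; last by rewrite /=; ring.
by move=> <-; apply: eq_bigr => Z _; rewrite big1 ?mulr1.
Qed.

Lemma Ex_cst (c : R) : Ex (fun=> c) = c.
Proof. by rewrite /Ex -big_distrl /= sum_rsw mul1r. Qed.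

Lemma ExD f g : Ex (fun Z => f Z + g Z) = Ex f + Ex g.
Proof. by rewrite /Ex -big_split /=; apply: eq_bigr => Z _; rewrite mulrDr. Qed.

Lemma ExZ (c : R) f : Ex (fun Z => c * f Z) = c * Ex f.
Proof. by rewrite /Ex big_distrr /=; apply: eq_bigr => Z _; rewrite mulrCA. Qed.

Lemma Ex_1B f : Ex (fun Z => 1 - f Z) = 1 - Ex f.
Proof.
rewrite -[X in X - _]Ex_cst -mulN1r -ExZ -ExD; apply: eq_Ex => Z.
by rewrite mulN1r.
Qed.

Lemma Ex_sum (I : Type) (r : seq I) (P : pred I) (F : I -> {set T} -> R) :
  Ex (fun Z => \sum_(i <- r | P i) F i Z) = \sum_(i <- r | P i) Ex (F i).
Proof.
rewrite /Ex exchange_big /=; apply: eq_bigr => Z _.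
by rewrite big_distrr.
Qed.

Lemma Ex_in_out (X Y : {set T}) : [disjoint X & Y] ->
  Pr (fun Z => (X \subset Z) && [disjoint Y & Z]) = p ^+ #|X| * (1 - p) ^+ #|Y|.
Proof.
move=> XY.
(* The indicator of the event is a product of one factor per element, so its mean factorises by
   [Ex_prodf]. *)
pose h e (b : bool) : R := if e \in X then b%:R else if e \in Y then (~~ b)%:R else 1.
rewrite /Pr (@eq_Ex _ (fun Z => \prod_e h e (e \in Z))); last first.
  move=> Z; case: (boolP (X \subset Z)) => /= [XZ|]; last first.
    case/subsetPn => e eX eZ; rewrite (bigD1 e) //= /h eX (negPf eZ).
    by rewrite mul0r.
  case: (boolP [disjoint Y & Z]) => [YZ|].
    rewrite big1 // => e _; rewrite /h; case: ifP => [/(subsetP XZ) -> //|_].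
    by case: ifP => // /(disjointFr YZ) ->.
  rewrite -setI_eq0 => /set0Pn [e /setIP[eY eZ]].
  by rewrite (bigD1 e) //= /h eZ eY (disjointFl XY eY) mul0r.
rewrite Ex_prodf (bigID (mem X)) /=; congr (_ * _).
  rewrite -prodr_const; apply: eq_bigr => e eX; by rewrite /h eX mulr1 mulr0 addr0.
rewrite (bigID (mem Y)) /= [X in _ * X]big1 ?mulr1; last first.
  by move=> e /andP[/negPf eX /negPf eY]; rewrite /h eX eY; ring.
rewrite (eq_bigl (mem Y)) => [|e]; last first.
  by rewrite /= andb_idl // => eY; rewrite (disjointFl XY eY).
rewrite -prodr_const; apply: eq_bigr => e; rewrite inE => eY; rewrite /h eY (disjointFl XY eY).
by rewrite mulr1 mulr0 add0r.
Qed.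

Lemma Pr_subset (X : {set T}) : Pr (fun Z => X \subset Z) = p ^+ #|X|.
Proof.
have := @Ex_in_out X set0; rewrite cards0 mulr1 -setI_eq0 setI0 eqxx => /(_ isT) <-.
by apply: eq_Ex => Z; rewrite -setI_eq0 set0I eqxx andbT.
Qed.

Definition dep_on D (U : Type) (f : {set T} -> U) := forall Z, f (Z :&: D) = f Z.

Lemma dep_onS D D' U (f : {set T} -> U) : D \subset D' -> dep_on D f -> dep_on D' f.
Proof.
move=> DD' fD Z; rewrite -fD -[RHS]fD; congr f.
by rewrite -setIA (setIidPr DD').
Qed.

(* Swapping the traces on D of two independent copies preserves the product weight. *)
Lemma Ex_indep D f g : dep_on D f -> dep_on (~: D) g ->
  Ex (fun Z => f Z * g Z) = Ex f * Ex g.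
Proof.
move=> fD gD.
pose mix Z Z' := (Z :&: D) :|: (Z' :&: ~: D).
pose phi (x : {set T} * {set T}) := (mix x.1 x.2, mix x.2 x.1).
have phiK : involutive phi.
  case=> Z Z'; rewrite /phi /mix /=; congr (_, _); apply/setP=> e; rewrite !inE;
  by case: (e \in D); rewrite !(andbT, andbF, orbF).
have -> : Ex f * Ex g = \sum_x (rsw x.1 * f x.1) * (rsw x.2 * g x.2).
  rewrite /Ex big_distrl /= -(pair_bigA _ (fun Z Z' => rsw Z * f Z * (rsw Z' * g Z'))).
  by apply: eq_bigr => Z _; rewrite big_distrr.
have -> : Ex (fun Z => f Z * g Z) = \sum_x (rsw x.1 * (f x.1 * g x.1)) * rsw x.2.
  rewrite -(pair_bigA _ (fun Z Z' => rsw Z * (f Z * g Z) * rsw Z')) /=.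
  by apply: eq_bigr => Z _; rewrite -big_distrr /= sum_rsw mulr1.
rewrite [RHS](reindex_inj (inv_inj phiK)); apply: eq_bigr => -[Z Z'] _ /=.
have -> : f (mix Z Z') = f Z.
  rewrite -fD -[RHS]fD; congr f; apply/setP=> e; rewrite !inE.
  by case: (e \in D); rewrite !(andbT, andbF, orbF).
have -> : g (mix Z' Z) = g Z.
  rewrite -gD -[RHS]gD; congr g; apply/setP=> e; rewrite !inE.
  by case: (e \in D); rewrite !(andbT, andbF, orbF).
have E : rsw (mix Z Z') * rsw (mix Z' Z) = rsw Z * rsw Z'.
  rewrite /rsw -!big_split /=; apply: eq_bigr => e _; rewrite !inE.
  by case: (e \in D); rewrite !(andbT, andbF, orbF) //= mulrC.
by rewrite mulrACA E; ring.
Qed.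


Lemma Ex_prod (I : Type) (r : seq I) (E : I -> {set T}) (F : I -> {set T} -> R) :
  (forall i, dep_on (E i) (F i)) -> pairwise (fun i j => [disjoint E i & E j]) r ->
  Ex (fun Z => \prod_(i <- r) F i Z) = \prod_(i <- r) Ex (F i).
Proof.
move=> dF; elim: r => [|i r IH].
  by move=> _; rewrite big_nil -[RHS](Ex_cst 1); apply: eq_Ex => Z; rewrite big_nil.
rewrite pairwise_cons => /andP[ir pr]; rewrite big_cons -IH //.
have dr : dep_on (~: E i) (fun Z => \prod_(j <- r) F j Z).
  move=> Z; elim: r ir {IH pr} => [|j r IH] /=; first by rewrite !big_nil.
  case/andP=> ij /IH {}IH; rewrite !big_cons IH; congr (_ * _).
  by apply: (dep_onS _ (dF j)); rewrite -disjoints_subset disjoint_sym.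
by rewrite -(Ex_indep (dF i) dr); apply: eq_Ex => Z; rewrite big_cons.
Qed.

(** Whether [X] lies in the random set depends only on the trace on [X], so disjoint sets give
    independent events. *)
Lemma Pr_none_subset (Es : seq {set T}) :
  pairwise (fun X Y : {set T} => [disjoint X & Y]) Es ->
  Pr (fun Z => all (fun X : {set T} => ~~ (X \subset Z)) Es) = \prod_(X <- Es) (1 - p ^+ #|X|).
Proof.
move=> dis; under [RHS]eq_bigr => X _ do rewrite -Pr_subset.
transitivity (Ex (fun Z => \prod_(X <- Es) (~~ (X \subset Z))%:R)).
  apply: eq_Ex => Z; elim: (Es) => [|X r IH] /=; first by rewrite big_nil.
  by rewrite big_cons -IH; case: (X \subset Z); rewrite /= ?mul0r ?mul1r.
rewrite (@Ex_prod _ _ id) //.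
  apply: eq_bigr => X _; rewrite /Pr -Ex_1B.
  by apply: eq_Ex => Z; case: (X \subset Z); rewrite /= ?subrr ?subr0.
by move=> X Z; rewrite subsetI subxx andbT.
Qed.

Hypotheses (p_ge0 : 0 <= p) (p_le1 : p <= 1).

Lemma rsw_ge0 Z : 0 <= rsw Z.
Proof. by apply: prodr_ge0 => e _; case: ifP => // _; rewrite subr_ge0. Qed.

Lemma le_Ex f g : (forall Z, f Z <= g Z) -> Ex f <= Ex g.
Proof. by move=> fg; apply: ler_sum => Z _; rewrite ler_wpM2l ?rsw_ge0. Qed.

Lemma Ex_ge0 f : (forall Z, 0 <= f Z) -> 0 <= Ex f.
Proof. by move=> f0; rewrite -(Ex_cst 0); apply: le_Ex. Qed.

Lemma le_Pr A A' : (forall Z, A Z -> A' Z) -> Pr A <= Pr A'.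
Proof.
move=> AA'; apply: le_Ex => Z; case AZ: (A Z); last exact: ler0n.
by rewrite AA'.
Qed.

Lemma Pr_le1 A : Pr A <= 1.
Proof. by rewrite -(Ex_cst 1); apply: le_Ex => Z; rewrite lern1 leq_b1. Qed.

Lemma PrC A : Pr (predC A) = 1 - Pr A.
Proof.
rewrite /Pr -Ex_1B.
by apply: eq_Ex => Z /=; case: (A Z); rewrite /= ?subrr ?subr0.
Qed.

Lemma Pr_or A A' : Pr (fun Z => A Z || A' Z) <= Pr A + Pr A'.
Proof.
rewrite /Pr -ExD; apply: le_Ex => Z.
by case: (A Z); case: (A' Z); rewrite /= ?addr0 ?add0r //; lra.
Qed.

Lemma Pr_exists (I : finType) (P : pred I) (F : I -> pred {set T}) :
  Pr (fun Z => [exists i in P, F i Z]) <= \sum_(i in P) Pr (F i).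
Proof.
rewrite /Pr -Ex_sum; apply: le_Ex => Z.
case: existsP => [[i /andP[Pi Fi]]|_]; last by apply: sumr_ge0 => i _; apply: ler0n.
rewrite (bigD1 i) //= Fi lerDl; apply: sumr_ge0 => j _; exact: ler0n.
Qed.

Lemma Ex_markov f A (c : R) : 0 < c -> (forall Z, 0 <= f Z) ->
  (forall Z, A Z -> c <= f Z) -> Pr A <= Ex f / c.
Proof.
move=> c0 f0 Af; rewrite ler_pdivlMr // mulrC -ExZ; apply: le_Ex => Z.
case AZ: (A Z); rewrite ?mulr1 ?mulr0 //; exact: Af.
Qed.

End RandomSubset.

(** * Saturation *)

Lemma in_graph_of_edges (T : finType) (E : {set {set T}}) e :
  (e \in edges (graph_of_edges E)) = (e \in E) && (e \in vpairs T).
Proof. exact: in_setI. Qed.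

(** Transfers events about G(n,p) to the product measure: each coordinate that is not a pair sums to
    a factor 1. *)
Lemma gnp_prE (R : realType) (p : R) n (A : pred (sgraph 'I_n)) :
  gnp_pr p A = Pr p (fun Z : {set {set 'I_n}} => A (graph_of_edges Z)).
Proof.
rewrite /gnp_pr /Pr /Ex.
rewrite (partition_big (@graph_of_edges 'I_n) predT) //= [RHS](bigID A) /=.
rewrite [X in _ = _ + X]big1 => [|G AG]; last first.
  by apply: big1 => Z /eqP ->; rewrite (negPf AG) mulr0.
rewrite addr0; apply: eq_bigr => G AG.
(* The product of the [h e] is the indicator of agreement with [G] on all pairs; other sets are left
   free. *)
pose h e (b : bool) : R :=
  if e \in vpairs 'I_n then ((b == (e \in edges G))%:R : R) else 1.
rewrite (eq_bigr (fun Z => rsw p Z * 1)); last first.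
  by move=> Z /eqP ZG; rewrite ZG AG.
have -> : \sum_(Z | graph_of_edges Z == G) rsw p Z * 1 =
    Ex p (fun Z => \prod_e h e (e \in Z)).
  rewrite big_mkcond /=; apply: eq_bigr => Z _; case: ifP => [/eqP ZG|ZG].
    rewrite big1 // => e _; rewrite /h -ZG in_graph_of_edges.
    by case: (e \in vpairs _) => //; rewrite andbT eqxx.
  have [e ev eZ] : exists2 e, e \in vpairs 'I_n & (e \in Z) != (e \in edges G).
    apply/exists_inP; apply: contraFT ZG; rewrite negb_exists_in => /forall_inP H.
    apply/eqP/val_inj => /=; apply/setP => e; rewrite in_setI.
    case ev: (e \in vpairs _); first by rewrite andbT; apply/eqP; have:= H e ev; rewrite negbK.
    rewrite andbF; apply/esym/negbTE; apply: contraFN ev.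
    by case: (G) => E EG /=; apply: (fintype.subsetP EG).
  by rewrite (bigD1 e) //= /h ev (negPf eZ) mul0r mulr0.
rewrite Ex_prodf /gnp_weight [RHS](bigID (mem (vpairs 'I_n))) /=.
rewrite [X in _ = _ * X]big1 ?mulr1 => [|e /negPf ev]; last by rewrite /h ev; ring.
apply: eq_bigr => e ev; rewrite /h ev.
by case: (e \in edges G); rewrite /= mulr1 mulr0 ?addr0 ?add0r.
Qed.

Lemma edge_pair (T : finType) (u v : T) : ([set u; v] \in vpairs T) = (u != v).
Proof. by rewrite inE cards2; case: (u != v). Qed.

Lemma edges_vpairs (T : finType) (H : sgraph T) e : e \in edges H -> e \in vpairs T.
Proof. by case: H => E EH /=; apply: (fintype.subsetP EH). Qed.

Lemma edgeP (T : finType) (H : sgraph T) e : e \in edges H -> exists u v, u != v /\ e = [set u; v].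
Proof.
move/edges_vpairs; rewrite inE => /cards2P [u [v [uv ->]]]; by exists u, v.
Qed.

(** * Cliques, saturated extensions and edge counts *)

Section Graphs.
Variable T : finType.
Implicit Types (G H : sgraph T) (u v w : T).

Definition is_clique H (W : {set T}) :=
  [forall u in W, forall v in W, (u != v) ==> ([set u; v] \in edges H)].

Lemma is_cliqueP H (W : {set T}) :
  reflect {in W &, forall u v, u != v -> [set u; v] \in edges H} (is_clique H W).
Proof.
apply: (iffP forall_inP) => [h u v uW vW uv|h u uW].
  by have /forall_inP/(_ v vW)/implyP/(_ uv) := h u uW.
by apply/forall_inP => v vW; apply/implyP; apply: h.
Qed.

Lemma has_copy_complete H s :
  reflect (exists2 W : {set T}, #|W| = s & is_clique H W) (has_copy H (complete_graph s)).
Proof.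
apply: (iffP existsP) => [[f /andP[/injectiveP finj /forall_inP fe]]|[W Ws /is_cliqueP Wc]].
  exists [set f i | i : 'I_s]; first by rewrite card_imset // card_ord.
  apply/is_cliqueP => _ _ /imsetP[i _ ->] /imsetP[j _ ->] ij.
  have /fe : [set i; j] \in edges (complete_graph s).
    rewrite in_graph_of_edges in_setT edge_pair; apply: contra ij => /eqP -> //.
  by rewrite imsetU1 imset_set1.
have Ws' : s = #|W| by [].
pose f := [ffun i : 'I_s => enum_val (cast_ord Ws' i)].
have finj : injective f.
  by move=> i j; rewrite !ffunE => /enum_val_inj /cast_ord_inj.
exists f; apply/andP; split; first exact/injectiveP.
apply/forall_inP => e /edgeP [i [j [ij ->]]].
rewrite imsetU1 imset_set1; apply: Wc; rewrite ?ffunE ?enum_valP //.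
by rewrite -!(ffunE (fun i : 'I_s => enum_val (cast_ord Ws' i))) (inj_eq finj).
Qed.

Lemma is_clique_sub H H' (W : {set T}) :
  edges H \subset edges H' -> is_clique H W -> is_clique H' W.
Proof.
move=> /subsetP HH' /is_cliqueP h; apply/is_cliqueP => u v uW vW uv; exact/HH'/h.
Qed.

Lemma has_copy_complete_sub H H' s : edges H \subset edges H' ->
  has_copy H (complete_graph s) -> has_copy H' (complete_graph s).
Proof.
by move=> HH' /has_copy_complete [W Ws Wc]; apply/has_copy_complete; exists W => //;
  apply: is_clique_sub HH' Wc.
Qed.

Lemma in_add_edge H e f : (f \in edges (add_edge H e)) =
  ((f == e) || (f \in edges H)) && (f \in vpairs T).
Proof. by rewrite in_graph_of_edges in_setU1. Qed.

Lemma has_copy_add_edge H u v (Q : {set T}) s : #|Q|.+2 = s -> u != v ->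
  u \notin Q -> v \notin Q -> is_clique H Q ->
  {in Q, forall w, [set u; w] \in edges H} -> {in Q, forall w, [set v; w] \in edges H} ->
  has_copy (add_edge H [set u; v]) (complete_graph s).
Proof.
move=> <- uv uQ vQ /is_cliqueP Qc uQe vQe; apply/has_copy_complete.
exists (u |: (v |: Q)); first by rewrite !cardsU1 !inE (negPf uv) (negPf uQ) (negPf vQ).
apply/is_cliqueP => a b; rewrite in_add_edge !in_setU1 => aW bW ab.
rewrite edge_pair ab andbT.
case/or3P: aW => [/eqP aE|/eqP aE|aQ]; case/or3P: bW => [/eqP bE|/eqP bE|bQ];
  try (subst; by rewrite eqxx in ab).
- by rewrite aE bE eqxx.
- by rewrite aE uQe ?orbT.
- by rewrite aE bE setUC eqxx.
- by rewrite aE vQe ?orbT.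
- by rewrite bE setUC uQe ?orbT.
- by rewrite bE setUC vQe ?orbT.
- by rewrite Qc ?orbT.
Qed.

(** The new clique must contain both ends of the new edge, and [3 <= s] leaves it a third vertex,
    whose edges to [u] and [v] were already in [H]. *)
Lemma add_edge_common_nbr H u v s : (3 <= s)%N -> ~~ has_copy H (complete_graph s) ->
  has_copy (add_edge H [set u; v]) (complete_graph s) ->
  exists w, ([set u; w] \in edges H) && ([set v; w] \in edges H).
Proof.
move=> s3 noH /has_copy_complete [W Ws /is_cliqueP Wc].
have [uvW|uvW] := boolP ((u \in W) && (v \in W)); last first.
  case/negP: noH; apply/has_copy_complete; exists W => //; apply/is_cliqueP => a b aW bW ab.
  have := Wc a b aW bW ab; rewrite in_add_edge => /andP[/orP[/eqP abE|//] _].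
  case/negP: uvW.
  have: u \in [set a; b] by rewrite abE !inE eqxx.
  have: v \in [set a; b] by rewrite abE !inE eqxx orbT.
  by rewrite !inE => /orP[]/eqP -> /orP[]/eqP ->; rewrite ?aW ?bW.
case/andP: uvW => uW vW.
have : (0 < #|W :\: [set u; v]|)%N.
  rewrite cardsD subn_gt0; apply: leq_ltn_trans (subset_leq_card (subsetIr _ _)) _.
  by rewrite Ws cards2; case: (u != v); lia.
case/card_gt0P => w; rewrite !inE negb_or => /andP[/andP[wu wv] wW].
exists w; apply/andP; split.
  have := Wc u w uW wW; rewrite eq_sym wu in_add_edge => /(_ isT).
  case/andP => /orP[/eqP E|//] _.
  have : w \in [set u; v] by rewrite -E !inE eqxx orbT.
  by rewrite !inE (negPf wu) (negPf wv).
have := Wc v w vW wW; rewrite eq_sym wv in_add_edge => /(_ isT).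
case/andP => /orP[/eqP E|//] _.
have : w \in [set u; v] by rewrite -E !inE eqxx orbT.
by rewrite !inE (negPf wu) (negPf wv).
Qed.

Lemma edges_graph_of_edges (E : {set {set T}}) : E \subset vpairs T ->
  edges (graph_of_edges E) = E.
Proof. by move=> /setIidPl. Qed.

Lemma saturated_extension G H s : edges H \subset edges G ->
  ~~ has_copy H (complete_graph s) ->
  exists2 H', saturated_in G (complete_graph s) H' & edges H \subset edges H'.
Proof.
move=> HG noH.
pose P (E : {set {set T}}) :=
  (E \subset edges G) && ~~ has_copy (graph_of_edges E) (complete_graph s).
have GV : edges G \subset vpairs T by apply/subsetP => e; apply: edges_vpairs.
have EV E : P E -> E \subset vpairs T by case/andP => /subset_trans /(_ GV).
have PH : P (edges H).
  rewrite /P HG /=; apply: contra noH; apply: has_copy_complete_sub.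
  exact: subsetIl.
have [E /maxsetP [PE maxE] HE] := maxset_exists PH.
exists (graph_of_edges E); rewrite ?edges_graph_of_edges ?EV //.
have /andP[EG Eno] := PE.
apply/and3P; split; rewrite ?edges_graph_of_edges ?EV //.
apply/forall_inP => e /setDP [eG eE]; apply: contraNT eE => nocopy.
have eV : e \in vpairs T by apply: edges_vpairs eG.
have PeE : P (e |: E).
  rewrite /P subUset sub1set eG EG /=; apply: contra nocopy; apply: has_copy_complete_sub.
  apply/subsetP => f; rewrite in_graph_of_edges in_add_edge in_setU1 in_graph_of_edges.
  by case/andP => /orP[] -> ->; rewrite ?orbT.
by rewrite -(maxE _ PeE (subsetUr _ _)) setU11.
Qed.

Lemma sat_le G H s : saturated_in G (complete_graph s) H ->
  (sat G (complete_graph s) <= #|edges H|)%N.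
Proof.
move=> Hs; rewrite /sat; have := mem_index_enum H.
elim: (index_enum _) => // K r IH; rewrite inE big_cons => /orP[/eqP <-|/IH le_r].
  by rewrite Hs geq_minl.
by case: ifP => // _; apply: leq_trans (geq_minr _ _) le_r.
Qed.

(** A saturated extension of [H] cannot use an edge that already completes a clique with [H]. Upper
    bounds on [sat] thus reduce to a clique-free [H] that has few edges and leaves few edges of [G]
    uncovered. *)
Lemma sat_le_uncovered G H s : edges H \subset edges G ->
  ~~ has_copy H (complete_graph s) ->
  (sat G (complete_graph s) <= #|edges H :|:
     [set e in edges G | ~~ has_copy (add_edge H e) (complete_graph s)]|)%N.
Proof.
move=> HG noH; have [H' H's HH'] := saturated_extension HG noH.
apply: leq_trans (sat_le H's) _; apply: subset_leq_card; apply/subsetP => e eH'.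
rewrite inE; case eH: (e \in edges H) => //=.
case/and3P: H's => H'G noH' _; rewrite inE (subsetP H'G) //=.
apply: contra noH'; apply: has_copy_complete_sub; apply/subsetP => f.
rewrite in_add_edge => /andP[/orP[/eqP -> //|fH] _]; exact: (subsetP HH').
Qed.

(** Shows that the default value in [sat] is harmless: the empty graph extends to a saturated one,
    so the minimum is attained. *)
Lemma sat_witness G s : (2 <= s)%N ->
  exists2 H, saturated_in G (complete_graph s) H &
    sat G (complete_graph s) = #|edges H|.
Proof.
move=> s2; pose H0 := @graph_of_edges T set0.
have noH0 : ~~ has_copy H0 (complete_graph s).
  apply/has_copy_complete => -[W Ws /is_cliqueP Wc].
  have /card_gt1P [u [v [uW vW uv]]] : (1 < #|W|)%N by rewrite Ws.
  by have := Wc u v uW vW uv; rewrite in_graph_of_edges in_set0.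
have H0G : edges H0 \subset edges G by apply/subsetP => e; rewrite in_graph_of_edges in_set0.
have [H Hs _] := saturated_extension H0G noH0.
have [H1 H1s minH1] := @arg_minnP _ H (saturated_in G (complete_graph s)) (fun H => #|edges H|) Hs.
exists H1 => //; apply/eqP; rewrite eqn_leq sat_le //=.
rewrite /sat; elim/big_ind: _ => [|a b|K Ks]; last exact: minH1.
  by case/and3P: H1s => /subset_leq_card.
by rewrite leq_min => -> ->.
Qed.

Definition nbr H v : {set T} := [set u | [set v; u] \in edges H].

Lemma in_nbr H v u : (u \in nbr H v) = ([set v; u] \in edges H).
Proof. by rewrite inE. Qed.

(** Double counting: every ordered adjacent pair is charged to its edge, and an edge is charged only
    by its two orderings. *)
Lemma sum_degrees H : (\sum_v #|nbr H v| <= 2 * #|edges H|)%N.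
Proof.
have -> : (\sum_v #|nbr H v| = \sum_v \sum_u ([set v; u] \in edges H))%N.
  by apply: eq_bigr => v _; rewrite -sum1_card big_mkcond /=;
     apply: eq_bigr => u _; rewrite in_nbr; case: (_ \in _).
have -> : (\sum_v \sum_u ([set v; u] \in edges H) =
   \sum_v \sum_u \sum_(e in edges H) ([set v; u] == e))%N.
  apply: eq_bigr => v _; apply: eq_bigr => u _; case: (boolP (_ \in _)) => vu.
    rewrite (bigD1 _ vu) /= eqxx big1 // => e /andP[_ /negPf]; by rewrite eq_sym => ->.
  rewrite big1 // => e eH; apply/eqP; rewrite eqb0; apply: contra vu => /eqP -> //.
rewrite mulnC -sum_nat_const.
under eq_bigr do rewrite exchange_big; rewrite exchange_big /=.
apply: leq_sum => e /edgeP [a [b [ab ->]]].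
rewrite (bigD1 a) //= [X in (_ + X)%N](bigD1 b) /=; last by rewrite eq_sym.
rewrite [X in (_ + (_ + X))%N]big1 ?addn0 => [|v /andP[va vb]]; last first.
  apply: big1 => u _; apply/eqP; rewrite eqb0; apply/eqP => E.
  have : v \in [set a; b] by rewrite -E !inE eqxx.
  by rewrite !inE (negPf va) (negPf vb).
have aux (x y z : T) : x != y -> ([set x; z] == [set x; y]) -> z = y.
  move=> xy /eqP E; have: y \in [set x; z] by rewrite E !inE eqxx orbT.
  by rewrite !inE eq_sym (negPf xy) /= => /eqP.
rewrite (bigD1 b) //= big1 ?addn0 => [|u ub]; last first.
  by apply/eqP; rewrite eqb0; apply: contra ub => /(aux _ _ _ ab) ->.
rewrite (bigD1 a) //= big1 ?addn0 => [|u ua]; last first.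
  apply/eqP; rewrite eqb0; apply: contra ua; rewrite [[set a; b]]setUC.
  by rewrite eq_sym in ab; move/(aux _ _ _ ab) => ->.
by rewrite (@leq_add _ _ 1 1) ?leq_b1.
Qed.

(** An edge with exactly one end in [A] determines which end is which, so no edge is counted
    twice. *)
Lemma bipartite_edges_le H (A : {set T}) :
  (\sum_(v in ~: A) #|nbr H v :&: A| <= #|edges H|)%N.
Proof.
pose P := [set x : T * T | (x.1 \notin A) && (x.2 \in nbr H x.1 :&: A)].
have -> : (\sum_(v in ~: A) #|nbr H v :&: A| = #|P|)%N.
  have -> : (#|P| = \sum_v \sum_u ((v, u) \in P))%N.
    rewrite pair_bigA -sum1_card big_mkcond; apply: eq_bigr => -[v u] _ /=.
    by case: (_ \in _).
  rewrite big_mkcond; apply: eq_bigr => v _; rewrite in_setC; case: ifP => vA; last first.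
    by rewrite big1 // => u _; rewrite in_set /= vA.
  rewrite -sum1_card big_mkcond; apply: eq_bigr => u _.
  by rewrite [in RHS]in_set /= vA; case: (_ \in _).
rewrite -(@card_in_imset _ _ (fun x : T * T => [set x.1; x.2]) (mem P)).
  apply: subset_leq_card; apply/subsetP => e /imsetP[[v u] vuP ->].
  by move: vuP; rewrite !inE => /and3P[].
move=> [v u] [v' u']; rewrite !inE /= => /and3P[vA _ uA] /and3P[vA' _ uA'] E.
have : v \in [set v'; u'] by rewrite -E !inE eqxx.
rewrite !inE => /orP[/eqP vv|/eqP vu]; last by rewrite vu uA' in vA.
have : u \in [set v'; u'] by rewrite -E !inE eqxx orbT.
rewrite !inE => /orP[/eqP vv'|/eqP ->]; last by rewrite vv.
by rewrite vv' (negPf vA') in uA.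
Qed.

End Graphs.

(** * Triangle-free hypergraphs without large independent sets *)

Section Hypergraphs.
Variable T : finType.
Implicit Types (q : {set T}) (qs : seq {set T}) (x y z : T).

(** The two edges may coincide, so any two vertices of a common edge are near. *)
Definition near2 qs x y := (x == y) ||
  has (fun q => (x \in q) && has (fun q' => (y \in q') && (q :&: q' != set0)) qs) qs.

(* No two vertices of an edge are joined by a path of at most two edges that come later in
   the list, so the hypergraph is linear and contains no triangle. *)
Fixpoint tri_free qs := if qs is q :: qs' then
  [forall x in q, forall y in q, (x != y) ==> ~~ near2 qs' x y] && tri_free qs' else true.

Definition shadow qs x y := (x != y) && has (fun q => (x \in q) && (y \in q)) qs.

Lemma shadow_sym qs x y : shadow qs x y = shadow qs y x.
Proof. by rewrite /shadow eq_sym; congr (_ && _); apply: eq_has => q; rewrite andbC. Qed.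

Lemma tri_free_cons q qs x y : tri_free (q :: qs) -> x != y -> x \in q -> y \in q ->
  ~~ near2 qs x y.
Proof. by case/andP => /forall_inP h _ xy /h /forall_inP /[apply] /implyP /(_ xy). Qed.

Lemma near2_edge qs q x y : q \in qs -> x \in q -> y \in q -> near2 qs x y.
Proof.
move=> qqs xq yq; apply/orP; right; apply/hasP; exists q; rewrite // xq.
by apply/hasP; exists q; rewrite // yq setIid; apply/set0Pn; exists x.
Qed.

(** Linearity of the hypergraph: of two different edges through [x] and [y], the one that comes
    first in the list would contain two vertices that a later edge joins. *)
Lemma shadow_edge_uniq qs x y : tri_free qs -> x != y ->
  {in qs &, forall q q', x \in q -> y \in q -> x \in q' -> y \in q' -> q = q'}.
Proof.
elim: qs => // q0 qs IH vq xy q q' qin q'in xq yq xq' yq'.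
have /andP[_ /IH {}IH] := vq.
have nq : x \in q0 -> y \in q0 -> {in qs, forall q1, x \in q1 -> y \in q1 -> False}.
  move=> x0 y0 q1 q1in x1 y1.
  by have := tri_free_cons vq xy x0 y0; rewrite (near2_edge q1in x1 y1).
move: qin q'in; rewrite !inE => /orP[/eqP qE|qin] /orP[/eqP qE'|q'in].
- by rewrite qE qE'.
- by subst q; case: (nq xq yq q' q'in xq' yq').
- by subst q'; case: (nq xq' yq' q qin xq yq).
- exact: (IH xy).
Qed.

Lemma near2_shadow qs x y z : shadow qs x z -> shadow qs y z -> near2 qs x y.
Proof.
case/andP => _ /hasP[q qin /andP[xq zq]] /andP[_ /hasP[q' q'in /andP[yq' zq']]].
apply/orP; right; apply/hasP; exists q; rewrite // xq; apply/hasP; exists q'; rewrite // yq'.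
by apply/set0Pn; exists z; rewrite inE zq zq'.
Qed.

(** Induction along the list. If the first edge held exactly two of the three vertices, later edges
    would join these two through the third, which [tri_free] forbids. So the first edge holds all
    three, or all three pairs come from later edges. *)
Lemma shadow_triangle qs x y z : tri_free qs ->
  shadow qs x y -> shadow qs x z -> shadow qs y z ->
  exists2 q, q \in qs & [&& x \in q, y \in q & z \in q].
Proof.
elim: qs => [|q qs IH vq]; first by rewrite /shadow /= andbF.
have /andP[_ /IH {}IH] := vq.
have out a b c : shadow (q :: qs) a b -> a \in q -> b \in q -> c \notin q ->
    shadow (q :: qs) a c -> shadow (q :: qs) b c -> False.
  move=> /andP[ab _] aq bq cq; rewrite /shadow /= (negPf cq) !andbF /= => ac bc.
  by have := tri_free_cons vq ab aq bq; rewrite (near2_shadow ac bc).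
have inn a b : shadow (q :: qs) a b -> a \in q /\ b \in q \/ shadow qs a b.
  rewrite /shadow /= => /andP[-> /orP[/andP[-> ->]|->]]; by [left|right].
move=> xy xz yz.
have [/and3P[xq yq zq]|nq] := boolP [&& x \in q, y \in q & z \in q].
  by exists q; rewrite ?mem_head // xq yq.
have [[xq yq]|xy'] := inn _ _ xy.
  by rewrite xq yq /= in nq; case: (out _ _ _ xy xq yq nq xz yz).
have [[xq zq]|xz'] := inn _ _ xz.
  rewrite xq zq /= andbT in nq.
  by case: (out _ _ _ xz xq zq nq xy); rewrite shadow_sym.
have [[yq zq]|yz'] := inn _ _ yz.
  rewrite yq zq /= andbT in nq.
  by case: (out _ _ _ yz yq zq nq); rewrite shadow_sym.
have [q' q'in h] := IH xy' xz' yz'.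
by exists q' => //; rewrite inE q'in orbT.
Qed.

(** A clique of the shadow lies inside one edge: two of its vertices determine the edge, and
    [shadow_triangle] puts every further vertex into it. *)
Lemma shadow_clique_le qs t (W : {set T}) : (0 < t)%N -> tri_free qs ->
  {in qs, forall q, #|q| <= t}%N ->
  {in W &, forall x y, x != y -> shadow qs x y} -> (#|W| <= t)%N.
Proof.
move=> t0 vq qt Wc; have [W1|/card_gt1P [x [y [xW yW xy]]]] := leqP #|W| 1.
  exact: leq_trans W1 t0.
have /andP[_ /hasP[q qin /andP[xq yq]]] := Wc x y xW yW xy.
apply: leq_trans (qt q qin); apply: subset_leq_card; apply/subsetP => z zW.
have [<- //|xz] := eqVneq x z; have [<- //|yz] := eqVneq y z.
have [q' q'in /and3P[xq' yq' zq']] := shadow_triangle vq (Wc _ _ xW yW xy)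
  (Wc _ _ xW zW xz) (Wc _ _ yW zW yz).
by rewrite (shadow_edge_uniq vq xy qin q'in xq yq xq' yq').
Qed.

Definition pairs_in q : {set {set T}} := [set e in vpairs T | e \subset q].

(** Linearity in the form used for independence: whether different edges span cliques of the random
    graph depends on disjoint sets of pairs. *)
Lemma tri_free_pairs_disjoint qs : tri_free qs ->
  pairwise (fun q q' => [disjoint pairs_in q & pairs_in q']) qs.
Proof.
elim: qs => // q qs IH vq; rewrite pairwise_cons IH; last by case/andP: vq.
rewrite andbT; apply/allP => q' q'in; rewrite -setI_eq0; apply/set0Pn => -[e].
rewrite inE !in_set => /andP[/andP[/cards2P [x [y [xy ->]]]]].
rewrite !subUset !sub1set => /andP[xq yq] /and3P[_ xq' yq'].
by have := tri_free_cons vq xy xq yq; rewrite (near2_edge q'in xq' yq').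
Qed.

Definition hdeg qs x := count (fun q => x \in q) qs.

Lemma sum_hdeg qs t : {in qs, forall q, #|q| <= t}%N ->
  (\sum_x hdeg qs x <= t * size qs)%N.
Proof.
elim: qs => [|q qs IH] qt; first by rewrite big1 // muln0.
rewrite big_split /= mulnS leq_add //; last first.
  by apply: IH => q' q'in; apply: qt; rewrite inE q'in orbT.
apply: leq_trans (qt q (mem_head _ _)); rewrite -sum1_card [leqRHS]big_mkcond.
by apply: leq_sum => x _; case: (x \in q).
Qed.

Lemma card_bigcup_seq_le (I : Type) (r : seq I) (P : pred I) (F : I -> {set T}) b :
  (forall i, P i -> #|F i| <= b)%N -> (#|\bigcup_(i <- r | P i) F i| <= count P r * b)%N.
Proof.
move=> Fb; elim: r => [|i r IH]; first by rewrite big_nil cards0.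
rewrite big_cons /=; case: ifP => // Pi.
rewrite mulnDl mul1n; apply: leq_trans (leq_card_setU _ _) _.
by rewrite leq_add ?Fb.
Qed.

Lemma card_near2_le qs t d x : {in qs, forall q, #|q| <= t}%N ->
  (forall y, hdeg qs y <= d)%N -> (#|[set y | near2 qs x y]| <= 1 + (d * t) * (d * t))%N.
Proof.
move=> qt qd.
pose N1 y := \bigcup_(q <- qs | y \in q) q.
have N1c y : (#|N1 y| <= d * t)%N.
  rewrite /N1 big_seq_cond.
  apply: leq_trans (card_bigcup_seq_le _ (b := t) _) _.
    by move=> q /andP[/qt].
  rewrite leq_mul2r; apply/orP; right; apply: leq_trans (qd y).
  by apply: sub_count => q /andP[].
have N1in y z q : q \in qs -> y \in q -> z \in q -> z \in N1 y.
  by move=> qin yq zq; rewrite /N1 (big_rem q) //= yq inE zq.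
have sub : [set y | near2 qs x y] \subset x |: \bigcup_(z in N1 x) N1 z.
  apply/subsetP => y; rewrite inE => /orP[/eqP ->|]; first exact: setU11.
  case/hasP => q qin /andP[xq /hasP[q' q'in /andP[yq' /set0Pn [z /setIP[zq zq']]]]].
  apply/setU1P; right; apply/bigcupP.
  by exists z; [exact: (N1in x z q)|exact: (N1in z y q')].
apply: leq_trans (subset_leq_card sub) _.
apply: leq_trans (leq_card_setU _ _) _; rewrite cards1 leq_add2l.
apply: leq_trans (_ : \sum_(z in N1 x) #|N1 z| <= _)%N.
  elim/big_rec2: _ => [|z a b _ le_ab]; first by rewrite cards0.
  by apply: leq_trans (leq_card_setU _ _) _; rewrite leq_add2l.
apply: leq_trans (_ : \sum_(z in N1 x) (d * t) <= _)%N.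
  by apply: leq_sum => z _; apply: N1c.
by rewrite sum_nat_const leq_mul2r N1c orbT.
Qed.

End Hypergraphs.

Lemma card_family_prod (I T : finType) (F : I -> {set T}) :
  #|[set f : {ffun I -> T} | [forall i, f i \in F i]]| = (\prod_i #|F i|)%N.
Proof.
transitivity #|family (fun i => mem (F i))|; last by rewrite card_family foldrE big_map big_enum.
by apply: eq_card => f; rewrite inE; apply/forallP/familyP.
Qed.

(** * Greedy choice of the next hyperedge *)

Section GreedyStep.
Variables (R : realType) (I T : finType).
Implicit Types (f : {ffun I -> T}) (qs : seq {set T}).

(** A candidate edge is given as an indexed tuple, so that candidates inside a set are counted by a
    power. Since [near2] is reflexive, the second condition also forces the entries to be
    distinct. *)
Definition allowed d qs f := [forall a, hdeg qs (f a) < d]%N &&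
  [forall a, forall b, (a != b) ==> ~~ near2 qs (f a) (f b)].

Lemma allowed_inj d qs f : allowed d qs f -> injective f.
Proof.
case/andP => _ /forallP h a b fab; apply/eqP; apply: contraT => ab.
by have /forallP/(_ b)/implyP/(_ ab) := h a; rewrite /near2 fab eqxx.
Qed.

Lemma allowed_tri_free d qs f : allowed d qs f -> tri_free qs ->
  tri_free ([set f a | a : I] :: qs).
Proof.
case/andP => _ /forallP h vq; rewrite /= vq andbT.
apply/forall_inP => _ /imsetP[a _ ->]; apply/forall_inP => _ /imsetP[b _ ->].
apply/implyP => fab; have /forallP/(_ b)/implyP := h a; apply.
by apply: contraNneq fab => ->.
Qed.

Lemma allowed_hdeg d qs f x : allowed d qs f -> (forall y, hdeg qs y <= d)%N ->
  (hdeg ([set f a | a : I] :: qs) x <= d)%N.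
Proof.
case/andP => /forallP h _ qd; rewrite /hdeg /=.
by case: (boolP (x \in _)) => [/imsetP[a _ ->]|_]; [apply: h|apply: qd].
Qed.

Lemma card_ffun_at (a : I) (S : {set T}) :
  (#|[set f : {ffun I -> T} | f a \in S]| * #|T| = #|S| * #|T| ^ #|I|)%N.
Proof.
have -> : [set f : {ffun I -> T} | f a \in S] =
    [set f : {ffun I -> T} | [forall i, f i \in (if i == a then S else setT)]].
  apply/setP => f; rewrite !inE; apply/idP/forallP => [fa i|/(_ a)]; last by rewrite eqxx.
  by case: eqP => [->//|_]; rewrite in_setT.
rewrite card_family_prod -prod_nat_const !(bigD1 a (P := predT)) //= eqxx -mulnA; congr (_ * _)%N.
rewrite mulnC; congr (_ * _)%N; apply: eq_bigr => i /negPf ->; exact: cardsT.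
Qed.

Lemma card_ffun_at2 (a b : I) (S S' : {set T}) : a != b ->
  (#|[set f : {ffun I -> T} | (f a \in S) && (f b \in S')]| * (#|T| * #|T|) =
   #|S| * #|S'| * #|T| ^ #|I|)%N.
Proof.
move=> ab.
have -> : [set f : {ffun I -> T} | (f a \in S) && (f b \in S')] = [set f : {ffun I -> T} |
    [forall i, f i \in (if i == a then S else if i == b then S' else setT)]].
  apply/setP => f; rewrite !inE; apply/andP/forallP => [[fa fb] i|h].
    by case: eqP => [->//|_]; case: eqP => [->//|_]; rewrite in_setT.
  by split; [have := h a|have := h b]; rewrite eqxx // eq_sym (negPf ab).
rewrite card_family_prod -prod_nat_const !(bigD1 a (P := predT)) //= eqxx.
have ba : b != a by rewrite eq_sym.
rewrite !(bigD1 b (P := fun i => i != a)) //= eqxx (negPf ba).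
rewrite (eq_bigr (fun=> #|T|)); first by ring.
by move=> i /andP[/negPf -> /negPf ->]; exact: cardsT.
Qed.

(** Union bound: some coordinate hits a vertex of full degree, or some two coordinates are near. The
    factor [#|T|] on the left avoids division. *)
Lemma card_not_allowed d nu qs :
  (forall x, #|[set y | near2 qs x y]| <= nu)%N ->
  (#|[set f : {ffun I -> T} | ~~ allowed d qs f]| * #|T| <=
    (#|I| * #|[set x | (d <= hdeg qs x)%N]| + #|I| * #|I| * nu) * #|T| ^ #|I|)%N.
Proof.
move=> qnu; set Hv := [set x | _].
have sub : [set f : {ffun I -> T} | ~~ allowed d qs f] \subset
   \bigcup_a [set f : {ffun I -> T} | f a \in Hv] :|:
   \bigcup_a \bigcup_(b | a != b) [set f : {ffun I -> T} | near2 qs (f a) (f b)].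
  apply/subsetP => f; rewrite inE negb_and => /orP[/forallPn [a]|].
    rewrite -leqNgt => fa; apply/setUP; left; apply/bigcupP; exists a => //.
    by rewrite !inE.
  case/forallPn => a /forallPn [b]; rewrite negb_imply negbK => /andP[ab h].
  by apply/setUP; right; apply/bigcupP; exists a => //; apply/bigcupP; exists b; rewrite ?inE.
have bc (J : finType) (P : pred J) (F : J -> {set {ffun I -> T}}) :
    (#|\bigcup_(j | P j) F j| <= \sum_(j | P j) #|F j|)%N.
  elim/big_rec2: _ => [|z x y _ le_xy]; first by rewrite cards0.
  by apply: leq_trans (leq_card_setU _ _) _; rewrite leq_add2l.
apply: leq_trans (_ : (\sum_a #|[set f : {ffun I -> T} | f a \in Hv]| +
   \sum_a \sum_(b | a != b) #|[set f : {ffun I -> T} | near2 qs (f a) (f b)]|) * #|T| <= _)%N.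
  rewrite leq_mul2r; apply/orP; right; apply: leq_trans (subset_leq_card sub) _.
  apply: leq_trans (leq_card_setU _ _) _; rewrite leq_add ?bc //.
  by apply: leq_trans (bc _ _ _) _; apply: leq_sum => a _; apply: bc.
rewrite mulnDl [leqRHS]mulnDl leq_add //.
  rewrite big_distrl /=; under eq_bigr do rewrite card_ffun_at.
  by rewrite sum_nat_const mulnA.
rewrite big_distrl /= -!mulnA -sum_nat_const; apply: leq_sum => a _.
rewrite big_distrl /= -sum_nat_const [leqRHS](bigID (fun b => a != b)) /=.
apply: leq_trans (leq_addr _ _); apply: leq_sum => b ab.
have [T0|Tpos] := posnP #|T|; first by rewrite T0 muln0.
rewrite -(leq_pmul2r Tpos) -mulnA.
have -> : #|[set f : {ffun I -> T} | near2 qs (f a) (f b)]| =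
   (\sum_x #|[set f : {ffun I -> T} | (f a \in [set x]) && (f b \in [set y | near2 qs x y])]|)%N.
  rewrite -sum1_card (partition_big (fun f : {ffun I -> T} => f a) predT) //=.
  apply: eq_bigr => x _; rewrite -sum1_card; apply: eq_bigl => f.
  by rewrite !inE andbC; case: eqP => // ->.
rewrite big_distrl /=.
under eq_bigr do rewrite card_ffun_at2 // cards1 mul1n.
apply: leq_trans (_ : \sum_(x : T) (nu * #|T| ^ #|I|) <= _)%N.
  by apply: leq_sum => x _; rewrite leq_mul2r qnu orbT.
by rewrite sum_nat_const mulnC.
Qed.

(** Weight function of a derandomisation: once the total is small, every single [Y] must contain
    many edges. *)
Definition potential (X : {set {set T}}) qs : R :=
  \sum_(Y in X) 2^-1 ^+ count (fun q : {set T} => q \subset Y) qs.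

(** Averaging over the allowed candidates. For each [Y] more than [beta * #|T| ^ #|I|] of them lie
    inside [Y], and these halve its term; so the average of the new potential is at most
    [1 - beta / 2] times the old one. *)
Lemma greedy_step (X : {set {set T}}) (d : nat) qs (beta : R) :
  0 <= beta -> 0 < #|T|%:R :> R ->
  #|[set f : {ffun I -> T} | ~~ allowed d qs f]|%:R <= beta * (#|T| ^ #|I|)%:R ->
  {in X, forall Y : {set T}, 2 * beta * (#|T| ^ #|I|)%:R < (#|Y| ^ #|I|)%:R :> R} ->
  X != set0 ->
  exists2 f, allowed d qs f &
    potential X ([set f a | a : I] :: qs) <= (1 - beta / 2) * potential X qs.
Proof.
move=> b0 T0 forb large /set0Pn [Y0 Y0X].
have in_al (Y : {set T}) : Y \in X -> beta * (#|T| ^ #|I|)%:R <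
    #|[set f : {ffun I -> T} | allowed d qs f && ([set f a | a : I] \subset Y)]|%:R :> R.
  move=> YX; have := large Y YX.
  have : (#|Y| ^ #|I| <= #|[set f : {ffun I -> T} | allowed d qs f && ([set f a | a : I] \subset Y)]| +
     #|[set f : {ffun I -> T} | ~~ allowed d qs f]|)%N.
    have <- : #|[set f : {ffun I -> T} | [forall i, f i \in Y]]| = (#|Y| ^ #|I|)%N.
      by rewrite card_family_prod prod_nat_const.
    apply: leq_trans (leq_card_setU _ _); apply: subset_leq_card; apply/subsetP => f.
    rewrite !inE => /forallP fY; case: (allowed d qs f) => //=; rewrite orbF.
    by apply/subsetP => _ /imsetP[a _ ->].
  rewrite -(ler_nat R) natrD => h1 h2.
  set A := (#|_|%:R : R) in h1 *; set B := (#|_|%:R : R) in h1 forb.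
  set C := (#|Y| ^ #|I|)%:R in h1 h2; set M := (#|T| ^ #|I|)%:R in forb h2 *.
  lra.
pose Al := [set f : {ffun I -> T} | allowed d qs f].
have AlM : #|Al|%:R <= (#|T| ^ #|I|)%:R :> R.
  by rewrite ler_nat -card_ffun max_card.
have Al0 : (0 < #|Al|)%N.
  have : 0 < #|[set f : {ffun I -> T} | allowed d qs f && ([set f a | a : I] \subset Y0)]|%:R :> R.
    by apply: le_lt_trans (in_al _ Y0X); rewrite mulr_ge0 ?ler0n.
  rewrite ltr0n => /card_gt0P [f]; rewrite inE => /andP[fa _].
  by apply/card_gt0P; exists f; rewrite inE.
have [/existsP [f /andP[fa fP]]|/existsPn none] := boolP [exists f, allowed d qs f &&
    (potential X ([set f a | a : I] :: qs) <= (1 - beta / 2) * potential X qs)].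
  by exists f.
(* If every allowed candidate failed, this sum would be strictly larger than the bound. *)
have : \sum_(f in Al) potential X ([set f a | a : I] :: qs) <=
    #|Al|%:R * ((1 - beta / 2) * potential X qs).
  rewrite /potential exchange_big /= mulrA mulr_sumr; apply: ler_sum => Y YX.
  under eq_bigr do rewrite exprD mulrC.
  rewrite -mulr_sumr mulrC ler_wpM2r ?exprn_ge0 ?invr_ge0 //.
  have -> : \sum_(f in Al) 2^-1 ^+ ([set f a | a : I] \subset Y) =
     #|Al|%:R - 2^-1 * #|[set f : {ffun I -> T} | allowed d qs f && ([set f a | a : I] \subset Y)]|%:R :> R.
    rewrite -!sum1_card !natr_sum mulr_sumr.
    rewrite [X in _ - X](eq_bigl (fun f => (f \in Al) && ([set f a | a : I] \subset Y))); last first.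
      by move=> f; rewrite !inE.
    rewrite [X in _ - X]big_mkcondr /= -sumrB; apply: eq_bigr => f _.
    by case: (_ \subset _); rewrite ?expr1 ?expr0; lra.
  have := in_al _ YX; set c := (#|_|%:R : R).
  have := ler_wpM2l b0 AlM; set M := (_ ^ _)%:R.
  by lra.
have /card_gt0P [f0 f0A] := Al0.
rewrite leNgt => /negP; case.
have -> : #|Al|%:R * ((1 - beta / 2) * potential X qs) =
   \sum_(f in Al) (1 - beta / 2) * potential X qs.
  by rewrite sumr_const -[RHS]mulr_natl.
apply: ltr_sum; first by apply/hasP; exists f0; rewrite ?mem_index_enum.
move=> f; rewrite inE => fa; have := none f; rewrite fa /= -ltNge //.
Qed.

End GreedyStep.

Lemma exists_nat_ge (R : realType) (x : R) : exists N : nat, x <= N%:R.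
Proof.
exists (Num.bound `|x|); apply: le_trans (ler_norm x) _; apply: ltW.
exact: archi_boundP.
Qed.

Lemma exists_small_pow (R : realType) (x e : R) : 0 <= x < 1 -> 0 < e ->
  exists N : nat, x ^+ N <= e.
Proof.
case/andP => x0 x1 e0; have x1' : `|x| < 1 by rewrite ger0_norm.
have /cvgr0Pnorm_lt /(_ e e0) [N _ /(_ N (leqnn N))] := cvg_expr x1'.
by rewrite /= ger0_norm ?exprn_ge0 // => /ltW; exists N.
Qed.

(** The greedy step is run [La * m] times. The potential starts at no more than [2 ^+ m], the number
    of all sets, and ends below [2^-1 ^+ (c * m)], which is less than the term of a set containing
    fewer than [c * m] edges. *)
Lemma exists_tri_free_hypergraph (R : realType) (t c : nat) (delta : R) :
  (0 < t)%N -> 0 < delta <= 1 ->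
  exists m0 : nat, forall m, (m0 <= m)%N -> exists qs : seq {set 'I_m},
    [/\ tri_free qs, {in qs, forall q : {set 'I_m}, #|q| = t} &
      forall Y : {set 'I_m}, delta * m%:R <= #|Y|%:R ->
        (c * m <= count (fun q : {set 'I_m} => q \subset Y) qs)%N].
Proof.
(* The divisor 4 makes twice [beta * m ^ t] smaller than [(delta * m) ^ t], the least number of
   tuples inside a large set. *)
move=> t0 /andP[d0 d1]; pose beta := delta ^+ t / 4.
have dt0 : 0 < delta ^+ t by rewrite exprn_gt0.
have dt1 : delta ^+ t <= 1 by rewrite exprn_ile1 // ltW.
have b0 : 0 < beta by rewrite divr_gt0.
have [La LaP] : exists N : nat, (1 - beta / 2) ^+ N <= 2^-1 ^+ c.+1 :> R.
  by apply: exists_small_pow; rewrite ?exprn_gt0 ?invr_gt0 // /beta; apply/andP; split; lra.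
(* The degree cap [d] and the threshold [m0] each make one of the two terms of [card_not_allowed] at
   most half of [beta]. *)
have [d dP] := exists_nat_ge (2 * (t * t * La)%:R / beta).
pose nu := (1 + (d * t) * (d * t))%N.
have [m0 m0P] := exists_nat_ge (2 * (t * t * nu)%:R / beta).
exists m0.+1 => m mm0.
have mpos : (0 < m)%N by apply: leq_trans mm0.
have mR : 0 < m%:R :> R by rewrite ltr0n.
pose X := [set Y : {set 'I_m} | delta * m%:R <= #|Y|%:R].
have X0 : X != set0.
  by apply/set0Pn; exists setT; rewrite inE cardsT card_ord ler_piMl ?ler0n.
have Xl : {in X, forall Y : {set 'I_m},
    2 * beta * (#|'I_m| ^ #|'I_t|)%:R < (#|Y| ^ #|'I_t|)%:R :> R}.
  move=> Y; rewrite inE !card_ord !natrX => Yd.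
  have Yt : (delta * m%:R) ^+ t <= #|Y|%:R ^+ t.
    by apply: lerXn2r Yd; rewrite nnegrE // mulr_ge0 // ltW.
  apply: lt_le_trans Yt; rewrite exprMn ltr_pM2r ?exprn_gt0 // /beta; lra.
have key (i : nat) : (i <= La * m)%N -> exists qs : seq {set 'I_m},
   [/\ size qs = i, tri_free qs, {in qs, forall q : {set 'I_m}, #|q| = t},
     (forall x, hdeg qs x <= d)%N & potential R X qs <= (1 - beta / 2) ^+ i * 2 ^+ m].
  elim: i => [_|i IH iL].
    exists [::]; split => //; rewrite expr0 mul1r /potential.
    rewrite (eq_bigr (fun=> 1)) // sumr_const.
    rewrite -natrX ler_nat -[m in (2 ^ m)%N]card_ord -cardsT -card_powerset.
    by apply: subset_leq_card; apply/subsetP => Y _; rewrite powersetE subsetT.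
  have [qs [sqs vqs tqs dqs pqs]] := IH (ltnW iL).
  have tqs' : {in qs, forall q : {set 'I_m}, #|q| <= t}%N by move=> q /tqs ->.
  have [] := @greedy_step R 'I_t _ X d qs beta (ltW b0) _ _ Xl X0.
  - by rewrite card_ord.
  - have := card_not_allowed 'I_t d (fun x => card_near2_le x tqs' dqs).
    rewrite -/nu -(ler_nat R) !card_ord !natrM natrD !natrM; set F := (#|_|%:R : R).
    set Hv := (#|_|%:R : R) => le1.
    (* Vertices of full degree are few because the degrees sum to at most [t] times the number of
       edges chosen so far. *)
    have le2 : d%:R * Hv <= t%:R * (La%:R * m%:R).
      rewrite -!natrM ler_nat; apply: leq_trans (_ : t * size qs <= _)%N; last first.
        by rewrite leq_mul2l sqs ltnW ?orbT.
      apply: leq_trans (sum_hdeg tqs'); rewrite mulnC -sum_nat_const.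
      rewrite [leqRHS](bigID (mem [set x | (d <= hdeg qs x)%N])) /=.
      by apply: leq_trans (leq_addr _ _); apply: leq_sum => x; rewrite inE.
    have H0 : 0 <= Hv by [].
    have le3 : t%:R * Hv <= beta / 2 * m%:R.
      have dpos : 0 <= d%:R :> R by [].
      rewrite ler_pdivrMr // !natrM in dP.
      have [La0|LaN] := posnP La.
        move: iL; rewrite La0 mul0n //.
      have LaR : 0 < La%:R :> R by rewrite ltr0n.
      have tR : 0 < t%:R :> R by rewrite ltr0n.
      have dgt : 0 < d%:R :> R.
        rewrite lt_neqAle dpos andbT; apply/eqP => d00; rewrite -d00 mul0r in dP.
        have : 0 < 2 * (t%:R * t%:R * La%:R) :> R by rewrite !mulr_gt0.
        by rewrite ltNge dP.
      rewrite -(ler_pM2l dgt) mulrCA.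
      apply: le_trans (ler_wpM2l (ltW tR) le2) _.
      have := ler_wpM2r (ltW mR) dP; lra.
    have le4 : t%:R * t%:R * nu%:R <= beta / 2 * m%:R.
      rewrite ler_pdivrMr // !natrM in m0P.
      have : m0%:R <= m%:R :> R by rewrite ler_nat ltnW.
      by move/(ler_wpM2r (ltW b0)); lra.
    rewrite -(ler_pM2r mR); apply: le_trans le1 _.
    rewrite [leRHS]mulrAC ler_wpM2r ?natrX ?exprn_ge0 //.
    by lra.
  move=> f fa fP; exists ([set f a | a : 'I_t] :: qs); split.
  - by rewrite /= sqs.
  - exact: allowed_tri_free fa vqs.
  - move=> q; rewrite inE => /orP[/eqP ->|/tqs //].
    by rewrite card_imset ?card_ord //; apply: allowed_inj fa.
  - by move=> x; apply: allowed_hdeg fa dqs.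
  apply: le_trans fP _; rewrite exprS -mulrA ler_wpM2l // /beta; lra.
have [qs [_ vqs tqs _ pqs]] := key (La * m)%N (leqnn _).
exists qs; split => // Y Yd; rewrite leqNgt; apply/negP => lt_c.
have : 2^-1 ^+ count (fun q : {set 'I_m} => q \subset Y) qs <= 2^-1 ^+ (c * m) :> R.
  have YX : Y \in X by rewrite inE.
  apply: le_trans (_ : potential R X qs <= _).
    rewrite /potential (bigD1 Y) //= lerDl; apply: sumr_ge0 => Z _.
    by rewrite exprn_ge0 ?invr_ge0.
  apply: le_trans pqs _; rewrite exprM -exprMn [_ ^+ (c * m)]exprM.
  rewrite lerXn2r ?nnegrE ?mulr_ge0 ?exprn_ge0 ?invr_ge0 // /beta; first by lra.
  have -> : 2^-1 ^+ c = 2^-1 ^+ c.+1 * 2 :> R.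
    by rewrite exprSr -mulrA mulVf ?mulr1 ?pnatr_eq0.
  by rewrite ler_pM2r.
rewrite leNgt => /negP; apply; rewrite ltr_iXn2l //; lra.
Qed.

(** * Lower bound *)

Lemma Ex_prod_set (R : realType) (T I : finType) (p : R) (U : {set I})
    (E : I -> {set T}) (F : I -> {set T} -> R) :
  (forall i, dep_on (E i) (F i)) ->
  {in U &, forall i j, i != j -> [disjoint E i & E j]} ->
  Ex p (fun Z => \prod_(i in U) F i Z) = \prod_(i in U) Ex p (F i).
Proof.
move=> dF dE; rewrite -[RHS]big_enum -(@Ex_prod _ _ _ _ _ E) //.
  by apply: eq_Ex => Z; rewrite -big_enum.
apply: (@sub_in_pairwise _ (mem U) (fun i j => i != j)).
- by move=> i j iU jU; apply: dE.
- by apply/allP => i; rewrite mem_enum.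
- by rewrite -uniq_pairwise enum_uniq.
Qed.

Lemma set2_inj (T : finType) (u w w' : T) : [set u; w] = [set u; w'] -> w = w'.
Proof.
move=> E; have : w \in [set u; w'] by rewrite -E !inE eqxx orbT.
rewrite !inE => /orP[/eqP wu|/eqP //].
have : w' \in [set u; w] by rewrite E !inE eqxx orbT.
by rewrite !inE wu orbb => /eqP.
Qed.

Definition star (T : finType) (u : T) (S : {set T}) : {set {set T}} :=
  [set [set u; w] | w in S].

Lemma card_star (T : finType) (u : T) (S : {set T}) : #|star u S| = #|S|.
Proof. by rewrite card_imset // => w w'; apply: set2_inj. Qed.

Lemma in_star (T : finType) (u w : T) (S : {set T}) : ([set u; w] \in star u S) = (w \in S).
Proof.
apply/imsetP/idP => [[w' w'S /set2_inj ->//]|wS]; by exists w.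
Qed.

Lemma star_disjoint (T : finType) (u u' : T) (S S' : {set T}) :
  u != u' -> u \notin S' -> [disjoint star u S & star u' S'].
Proof.
move=> uu uS; rewrite -setI_eq0; apply/set0Pn => -[e /setIP[/imsetP[w wS ->] /imsetP[w' w'S E]]].
have : u \in [set u'; w'] by rewrite -E !inE eqxx.
by rewrite !inE (negPf uu) /= => /eqP uw; rewrite uw w'S in uS.
Qed.

Section Lower.
Variable T : finType.

Definition free_nbrs (Z : {set {set T}}) v (S : {set T}) : {set T} :=
  [set u in ~: (v |: S) | ([set u; v] \in Z) && [disjoint star u S & Z]].

(** Markov's inequality for 2 to the power minus the number of free neighbours. This is a product of
    independent factors, the one for [u] depending only on the pairs from [u] to [v |: S]. *)
Lemma Pr_few_free_nbrs (R : realType) (p : R) v (S : {set T}) r :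
  0 <= p <= 1 -> v \notin S ->
  Pr p (fun Z => (#|free_nbrs Z v S| <= r)%N) <=
    2 ^+ r * (1 - p * (1 - p) ^+ #|S| / 2) ^+ (#|T| - #|S|.+1).
Proof.
move=> /andP[p0 p1] vS.
pose U := ~: (v |: S).
pose ind u (Z : {set {set T}}) := ([set [set u; v]] \subset Z) && [disjoint star u S & Z].
pose F u Z : R := 1 - 2^-1 * (ind u Z)%:R.
have EF u : u \in U -> Ex p (F u) = 1 - p * (1 - p) ^+ #|S| / 2.
  move=> uU; rewrite Ex_1B ExZ -/(Pr p (ind u)) Ex_in_out ?cards1 ?card_star ?expr1 1?mulrC //.
  by rewrite -setI_eq0; apply/set0Pn => -[e /setIP[/set1P ->]]; rewrite in_star (negPf vS).
have EP : Ex p (fun Z => \prod_(u in U) F u Z) =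
    (1 - p * (1 - p) ^+ #|S| / 2) ^+ (#|T| - #|S|.+1).
  rewrite (@Ex_prod_set _ _ _ _ _ (fun u => star u (v |: S))).
  - rewrite (eq_bigr _ EF) prodr_const; congr (_ ^+ _).
    by rewrite [#|U|]cardsCs setCK cardsU1 vS.
  - move=> u Z; rewrite /F /ind; congr (1 - _ * (nat_of_bool _)%:R); congr (_ && _).
      by rewrite !sub1set inE in_star setU11 andbT.
    rewrite -!setI_eq0; congr (_ == _); apply/setP => e; rewrite !in_setI.
    case: (boolP (e \in star u S)) => //= /imsetP[w wS ->].
    by rewrite in_star in_setU1 wS orbT andbT.
  - move=> u u'; rewrite !in_setC => uU uU' uu; exact: star_disjoint.
have -> : 2 ^+ r = (2^-1 ^+ r)^-1 :> R by rewrite exprVn invrK.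
rewrite -EP mulrC.
apply: (@Ex_markov _ _ _ p0 p1) => [|Z|Z].
- by rewrite exprn_gt0 ?invr_gt0.
- apply: prodr_ge0 => u _; rewrite /F; case: (ind u Z) => /=; lra.
move=> le_r.
have -> : \prod_(u in U) F u Z = 2^-1 ^+ #|free_nbrs Z v S|.
  rewrite (bigID (ind^~ Z)) /= [X in _ * X]big1 ?mulr1; last first.
    by move=> u /andP[_ /negPf h]; rewrite /F h mulr0 subr0.
  rewrite -prodr_const; apply: eq_big => [u|u /andP[_ h]].
    by rewrite [in RHS]in_set /ind sub1set.
  by rewrite /F h mulr1; lra.
by rewrite ler_wiXn2l ?invr_ge0 //; lra.
Qed.

Lemma card_small_sets k : (0 < #|T|)%N ->
  (#|[set S : {set T} | #|S| <= k]| <= k.+1 * #|T| ^ k)%N.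
Proof.
move=> T0.
have -> : [set S : {set T} | #|S| <= k]%N = \bigcup_(j < k.+1) [set S : {set T} | #|S| == j].
  apply/setP => S; rewrite inE; apply/idP/bigcupP => [Sk|[j _]].
    by exists (Ordinal (Sk : #|S| < k.+1)%N); rewrite ?inE.
  by rewrite inE => /eqP ->; rewrite -ltnS.
apply: leq_trans (_ : \sum_(j < k.+1) #|[set S : {set T} | #|S| == j]| <= _)%N.
  elim/big_rec2: _ => [|z x y _ le_xy]; first by rewrite cards0.
  by apply: leq_trans (leq_card_setU _ _) _; rewrite leq_add2l.
have -> : (k.+1 * #|T| ^ k = \sum_(j < k.+1) #|T| ^ k)%N.
  by rewrite sum_nat_const card_ord.
apply: leq_sum => j _; rewrite card_draws; apply: leq_trans (_ : #|T| ^ j <= _)%N; last first.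
  by rewrite leq_pexp2l // -ltnS.
apply: leq_trans (leq_pmulr _ (fact_gt0 j)) _; rewrite bin_ffact ffact_prod.
apply: leq_trans (_ : \prod_(i < j) #|T| <= _)%N; last by rewrite prod_nat_const card_ord.
by apply: leq_prod => i _; apply: leq_subr.
Qed.

(** [D] is the degree threshold that defines [A]. A vertex outside [A] reaches at most [D + D * D]
    vertices of [H] directly or through a neighbour outside [A], which is too few for its free
    neighbours. *)
Lemma saturated_lower (G H : sgraph T) s (D k : nat) : (3 <= s)%N ->
  saturated_in G (complete_graph s) H ->
  (forall v (S : {set T}), v \notin S -> #|S| <= k -> D + D * D < #|free_nbrs (edges G) v S|)%N ->
  exists2 A : {set T}, (#|A| * D <= 2 * #|edges H|)%N &
    ((#|T| - #|A|) * k.+1 <= #|edges H|)%N.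
Proof.
move=> s3 /and3P[HG noH /forall_inP satH] free.
pose A := [set w | D <= #|nbr H w|]%N.
exists A.
  apply: leq_trans (sum_degrees H); rewrite -sum_nat_const.
  rewrite [leqRHS](bigID (mem A)) /=; apply: leq_trans (leq_addr _ _).
  by apply: leq_sum => w; rewrite inE.
apply: leq_trans (bipartite_edges_le H A).
have -> : (#|T| - #|A| = #|~: A|)%N by rewrite [#|~: A|]cardsCs setCK.
rewrite -sum_nat_const; apply: leq_sum => v; rewrite in_setC => vA.
rewrite ltnNge; apply/negP => Sk; set S := nbr H v :&: A in Sk.
have vS : v \notin S by rewrite inE negb_and vA orbT.
have := free v S vS Sk; apply/negP; rewrite -leqNgt.
have degD w : w \notin A -> (#|nbr H w| <= D)%N by rewrite inE -ltnNge => /ltnW.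
(* A free neighbour not adjacent to [v] in [H] shares an [H]-neighbour [w] with it by saturation. If
   [w] were in [A] it would be in [S], where a free neighbour has no neighbour. *)
have sub : free_nbrs (edges G) v S \subset
    nbr H v :|: \bigcup_(w in nbr H v :\: A) nbr H w.
  apply/subsetP => u; rewrite in_set => /and3P[]; rewrite in_setC in_setU1 negb_or.
  case/andP => uv uS uvG dis; apply/setUP.
  case uvH : ([set u; v] \in edges H); first by left; rewrite in_nbr setUC.
  have /satH : [set u; v] \in edges G :\: edges H by rewrite in_setD uvH uvG.
  case/(add_edge_common_nbr s3 noH) => w /andP[uwH vwH].
  right; apply/bigcupP; exists w; last by rewrite in_nbr setUC.
  rewrite in_setD in_nbr vwH andbT; apply/negP => wA.
  have wS : w \in S by rewrite in_setI in_nbr vwH.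
  have := disjointFr dis (_ : [set u; w] \in star u S); rewrite in_star => /(_ wS).
  by rewrite (fintype.subsetP HG).
apply: leq_trans (subset_leq_card sub) _; apply: leq_trans (leq_card_setU _ _) _.
apply: leq_add; first exact: degD.
apply: leq_trans (_ : \sum_(w in nbr H v :\: A) #|nbr H w| <= _)%N.
  elim/big_rec2: _ => [|z x y _ le_xy]; first by rewrite cards0.
  by apply: leq_trans (leq_card_setU _ _) _; rewrite leq_add2l.
apply: leq_trans (_ : \sum_(w in nbr H v :\: A) D <= _)%N.
  by apply: leq_sum => w; rewrite inE => /andP[wA _]; apply: degD.
rewrite sum_nat_const leq_mul2r; apply/orP; right.
by apply: leq_trans (degD _ vA); apply: subset_leq_card; apply: subsetDl.
Qed.

Lemma free_nbrs_graph (Z : {set {set T}}) v (S : {set T}) :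
  free_nbrs (edges (graph_of_edges Z)) v S = free_nbrs Z v S.
Proof.
apply/setP => u; rewrite [LHS]in_set [RHS]in_set in_setC in_setU1.
have [//|] := boolP ((u == v) || (u \in S)); rewrite negb_or /= => /andP[uv uS].
rewrite in_graph_of_edges edge_pair uv andbT.
congr (_ && _); rewrite -!setI_eq0; congr (_ == _); apply/setP => e; rewrite !in_setI.
case: (boolP (e \in star u S)) => //= /imsetP[w wS ->].
rewrite edge_pair [u != w](_ : _ = true) ?andbT //.
by apply: contraNneq uS => ->.
Qed.

End Lower.

(** Union bound over [v] and [S]; the worst size of [S] is [k]. *)
Lemma Pr_bad_lower (R : realType) (p : R) n (k r : nat) : 0 <= p <= 1 -> (0 < n)%N ->
  Pr p (fun Z : {set {set 'I_n}} => [exists x : 'I_n * {set 'I_n} in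
      [pred x : 'I_n * {set 'I_n} | (x.1 \notin x.2) && (#|x.2| <= k)%N],
      (#|free_nbrs Z x.1 x.2| <= r)%N]) <=
  (n * (k.+1 * n ^ k))%:R * (2 ^+ r * (1 - p * (1 - p) ^+ k / 2) ^+ (n - k.+1)).
Proof.
move=> /andP[p0 p1] n0; apply: le_trans (Pr_exists p0 p1 _ _) _.
set B := 2 ^+ r * _.
have q0 j : 0 <= p * (1 - p) ^+ j <= 1.
  rewrite mulr_ge0 ?exprn_ge0 ?subr_ge0 //= mulr_ile1 ?exprn_ge0 ?subr_ge0 //.
  by rewrite exprn_ile1 ?subr_ge0 // lerBlDr lerDl.
have qk0 := q0 k.
have h0 : 0 <= 1 - p * (1 - p) ^+ k / 2 <= 1 by apply/andP; split; lra.
apply: le_trans (_ : \sum_(x in [pred x : 'I_n * {set 'I_n} |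
    (x.1 \notin x.2) && (#|x.2| <= k)%N]) B <= _).
  apply: ler_sum => -[v S]; rewrite inE /= => /andP[vS Sk].
  apply: le_trans (Pr_few_free_nbrs r _ vS) _; first by rewrite p0.
  rewrite /B card_ord ler_wpM2l ?exprn_ge0 //.
  apply: le_trans (_ : (1 - p * (1 - p) ^+ k / 2) ^+ (n - #|S|.+1) <= _); last first.
    case/andP: h0 => h0 h1; apply: ler_wiXn2l => //; apply: leq_sub2l; exact: Sk.
  apply: lerXn2r; rewrite ?nnegrE; [have := q0 #|S|; lra|lra|].
  have : p * (1 - p) ^+ k <= p * (1 - p) ^+ #|S|; last by lra.
  by rewrite ler_wpM2l // ler_wiXn2l ?subr_ge0 // lerBlDr lerDl.
rewrite sumr_const -[B *+ _]mulr_natl ler_wpM2r //.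
  by rewrite mulr_ge0 ?exprn_ge0 //; case/andP: h0.
rewrite ler_nat.
apply: leq_trans (_ : #|setX [set: 'I_n] [set S : {set 'I_n} | #|S| <= k]| <= _)%N.
  apply: subset_leq_card; apply/subsetP => -[v S]; rewrite inE /= => /andP[_ Sk].
  by rewrite !inE.
rewrite cardsX cardsT card_ord leq_mul2l orbC.
by have := @card_small_sets 'I_n k; rewrite card_ord => ->.
Qed.

(** * Analytic estimates *)

Lemma ln_nat_ge (R : realType) (X : R) :
  exists N : nat, forall n, (N <= n)%N -> (0 < n)%N /\ X <= ln n%:R.
Proof.
have [N NP] := exists_nat_ge (expR X); exists N => n Nn.
have n0 : 0 < n%:R :> R.
  by apply: lt_le_trans (expR_gt0 X) _; apply: le_trans NP _; rewrite ler_nat.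
split; first by rewrite ltr0n in n0.
rewrite -[X]expRK ler_ln ?posrE ?expR_gt0 //.
by apply: le_trans NP _; rewrite ler_nat.
Qed.

Lemma exists_floor (R : realType) (y : R) : 0 <= y ->
  exists k : nat, k%:R <= y /\ y < k.+1%:R.
Proof. by move=> y0; exists (Num.truncn y); apply/andP; exact: truncn_itv. Qed.

Lemma poly_le_expR (R : realType) (a e : R) : 0 <= a -> 0 < e ->
  exists X : R, forall x, X <= x -> 1 <= x /\ a * (1 + x) ^+ 2 <= expR (e * x).
Proof.
(* 108 is 4 * 27: the bound [4 * x ^+ 2] for [(1 + x) ^+ 2] gives 4, and the cube of [e * x / 3], a
   lower bound for the exponential, gives 27. *)
move=> a0 e0; exists (1 + 108 * a / e ^+ 3) => x Xx.
have e3 : 0 < e ^+ 3 by rewrite exprn_gt0.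
have X1 : 0 <= 108 * a / e ^+ 3 by rewrite divr_ge0 ?mulr_ge0 // ltW.
have x1 : 1 <= x by lra.
split => //.
have -> : e * x = 3%:R * (e * x / 3) by field.
rewrite expRM_natl.
have h : e * x / 3 <= expR (e * x / 3).
  by apply: le_trans (expR_ge1Dx _); lra.
have y0 : 0 <= e * x / 3 by rewrite divr_ge0 ?mulr_ge0 // ?ltW //; lra.
apply: le_trans (_ : (e * x / 3) ^+ 3 <= _); last first.
  by apply: lerXn2r h; rewrite nnegrE // expR_ge0.
have h2 : 108 * a <= e ^+ 3 * x.
  by rewrite -ler_pdivrMl // mulrC; lra.
have -> : (e * x / 3) ^+ 3 = (e ^+ 3 * x) * x ^+ 2 / 27 by field.
have h3 : 108 * a * x ^+ 2 <= e ^+ 3 * x * x ^+ 2 by rewrite ler_wpM2r ?sqr_ge0.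
apply: le_trans (_ : a * (4 * x ^+ 2) <= _); last by lra.
by rewrite ler_wpM2l //; nra.
Qed.

Lemma logb_base_gt0 (R : realType) (p : R) : 0 < p -> p < 1 -> 0 < ln (1 / (1 - p)).
Proof. by move=> p0 p1; rewrite ln_gt0 // ltr_pdivlMr; lra. Qed.

Lemma expRN_logb_base (R : realType) (p : R) : p < 1 -> expR (- ln (1 / (1 - p))) = 1 - p.
Proof.
by move=> p1; rewrite expRN lnK ?posrE ?divr_gt0 // ?invf_div ?divr1 //; lra.
Qed.

Lemma expR_nat_ln (R : realType) n : (0 < n)%N -> expR (ln n%:R) = n%:R :> R.
Proof. by move=> n0; rewrite lnK ?posrE ?ltr0n. Qed.

(** The final comparison of exponents in the lower bound, where [Y] is the square of [1 + ln n], [E]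
    is of order n to a positive power, and [G] is the logarithm of the target probability. *)
Lemma exponent_sum_le (R : realType) (y A C E F G Y u v : R) :
  (1 + u + v + F) * Y <= E -> C <= v * Y -> A <= u * Y -> y <= Y ->
  - G <= F -> F <= F * Y -> y + A + (C - E) <= G.
Proof. lra. Qed.

(** One factor [1 - eps] accounts for the vertices lost to [A], the other for the number of
    neighbours in [A]. *)
Lemma sat_lower_whp (R : realType) (p eps : R) (s : nat) :
  0 < p -> p < 1 -> (3 <= s)%N -> 0 < eps -> eps < 1 ->
  exists N : nat, forall n, (N <= n)%N ->
    gnp_pr p (fun G : sgraph 'I_n => (sat G (complete_graph s))%:R <
      (1 - eps) ^+ 2 * (n%:R * logb (1 / (1 - p)) n%:R)) <= eps.
Proof.
move=> p0 p1 s3 e0 e1; set c := ln (1 / (1 - p)).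
have c0 : 0 < c by apply: logb_base_gt0.
have cE : expR (- c) = 1 - p by apply: expRN_logb_base.
pose d1 := 2 / (c * eps) + 1.
have d10 : 0 <= d1 by rewrite addr_ge0 // divr_ge0 // ltW // mulr_gt0.
(* Sum of the coefficients of [(1 + x) ^+ 2] in the bounds [xB], [LB] and [rB] below. *)
pose a := 1 + 2 / c + (d1 + d1 ^+ 2).
have ic0 : 0 < c^-1 by rewrite invr_gt0.
have c20 : 0 <= 2 / c by rewrite mulr_ge0 // ltW.
have a0 : 0 <= a by have := sqr_ge0 d1; rewrite /a; lra.
have [X1 X1P] := @poly_le_expR R ((a + `|ln eps|) * (4 / p)) eps
  (mulr_ge0 (addr_ge0 a0 (normr_ge0 _)) (divr_ge0 (ler0n _ _) (ltW p0))) e0.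
have b0 : 0 <= 2 / c + 2 by lra.
(* This threshold makes [k.+1] at most half of [n]. *)
have [X2 X2P] := @poly_le_expR R (2 / c + 2) 1 b0 ltr01.
have [N NP] := ln_nat_ge (Num.max X1 X2); exists N => n /NP [n0].
rewrite ge_max => /andP[/X1P [x1 le1] /X2P [_ le2]].
set x := ln n%:R in x1 le1 le2.
have nE : n%:R = expR x by rewrite expR_nat_ln.
rewrite /logb -/c -/x; set L := x / c.
have L0 : 0 < L by rewrite divr_gt0 //; lra.
have kL0 : 0 <= (1 - eps) * L by rewrite mulr_ge0 ?subr_ge0 // ltW.
(* Rounding down suffices, since [saturated_lower] yields [k.+1] edges per vertex. *)
have [k [kle klt]] := exists_floor kL0.
have DL0 : 0 <= 2 * L / eps.
  by rewrite divr_ge0 ?(ltW e0) // mulr_ge0 // ltW.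
(* If [H] has at most [n * L] edges, then [#|A| * D] is at most [2 * n * L], so this choice bounds
   [A] by [eps * n]. *)
have [D [DD Dlt]] : exists D : nat, D%:R <= 2 * L / eps + 1 /\ 2 * L / eps < D%:R.
  have [D [Dle Dlt]] := exists_floor DL0.
  by exists D.+1; split=> //; rewrite -natr1 lerD2r.
have kL : k%:R <= L by apply: le_trans kle _; rewrite ler_piMl // ?ltW //; lra.
rewrite gnp_prE.
apply: le_trans (_ : Pr p (fun Z : {set {set 'I_n}} => [exists x : 'I_n * {set 'I_n} in
      [pred x : 'I_n * {set 'I_n} | (x.1 \notin x.2) && (#|x.2| <= k)%N],
      (#|free_nbrs Z x.1 x.2| <= D + D * D)%N]) <= _).
  apply: le_Pr; rewrite ?ltW // => Z.
  have [H Hs ->] := sat_witness (graph_of_edges Z) (ltnW s3).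
  apply: contraTT => /exists_inPn none; rewrite -leNgt.
  have [|A Ad Ab] := @saturated_lower _ _ _ _ D k s3 Hs.
    move=> v S vS Sk; rewrite free_nbrs_graph ltnNge.
    by have := none (v, S); rewrite inE /= vS Sk => /(_ isT).
  rewrite leNgt; apply/negP => small.
  move: Ad Ab; rewrite -!(ler_nat R) !natrM card_ord.
  set h := (#|edges H|%:R : R) in small *.
  have nn : 0 < n%:R :> R by rewrite ltr0n.
  have le_h : h <= n%:R * L.
    apply: le_trans (ltW small) _; apply: ler_piMl; first by rewrite mulr_ge0 // ltW.
    by apply: exprn_ile1; lra.
  move=> Ad Ab.
  have Aeps : #|A|%:R <= eps * n%:R.
    rewrite -(ler_pM2r (_ : 0 < 2 * L / eps)); last by rewrite divr_gt0 // mulr_gt0.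
    apply: le_trans (_ : #|A|%:R * D%:R <= _); first by rewrite ler_wpM2l // ltW.
    apply: le_trans Ad _; have -> : eps * n%:R * (2 * L / eps) = 2 * (n%:R * L) by field; lra.
    by rewrite ler_pM2l.
  have AT : (#|A| <= n)%N by have := max_card (mem A); rewrite card_ord.
  move: small; apply/negP; rewrite -leNgt; apply: le_trans Ab.
  rewrite natrB //.
  have -> : (1 - eps) ^+ 2 * (n%:R * L) = (1 - eps) * n%:R * ((1 - eps) * L) by ring.
  apply: ler_pM => //; [by rewrite mulr_ge0 ?subr_ge0 // ltW| |exact: ltW].
  lra.
apply: le_trans (Pr_bad_lower _ _ _ n0) _; first by rewrite !ltW.
move rE : (D + D * D)%N => r; set q := p * _.
(* With [k] at most [(1 - eps) * L], the power [(1 - p) ^+ k] is at least n to the power [eps - 1];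
   about n trials then give an exponent of order n to the power [eps], which beats every power of
   [ln n]. *)
have qE : p * expR (- ((1 - eps) * x)) <= q.
  rewrite /q ler_pM2l // -cE -expRM_natl ler_expR mulrN lerN2.
  have -> : (1 - eps) * x = (1 - eps) * L * c by rewrite /L; field; lra.
  by rewrite ler_pM2r.
have q0 : 0 <= q <= 1.
  rewrite /q mulr_ge0 ?exprn_ge0 ?subr_ge0 ?(ltW p0) ?(ltW p1) //=.
  by rewrite mulr_ile1 ?exprn_ge0 ?exprn_ile1 ?subr_ge0 ?(ltW p0) ?(ltW p1) //; lra.
have kn : n%:R / 2 <= (n - k.+1)%:R :> R.
  have hL : L <= (1 / c) * (1 + x) ^+ 2.
    by rewrite /L [x / c]mulrC mul1r ler_pM2l //; nra.
  have k1 : (k.+1)%:R <= n%:R / 2 :> R.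
    rewrite nE -natr1; move: le2; rewrite mul1r => le2; nra.
  have kn' : (k.+1 <= n)%N by rewrite -(ler_nat R); lra.
  by rewrite natrB //; lra.
rewrite !natrM natrX nE.
have h2 : k.+1%:R <= expR L.
  by apply: le_trans (expR_ge1Dx _); rewrite -natr1 addrC lerD2l.
have h3 : expR x ^+ k <= expR (L * x).
  by rewrite -expRM_natl ler_expR ler_wpM2r //; lra.
have h4 : 2 ^+ r <= expR r%:R :> R.
  rewrite -[r%:R]mulr1 expRM_natl; apply: lerXn2r; rewrite ?nnegrE ?expR_ge0 //.
  by apply: le_trans (expR_ge1Dx _); lra.
have h5 : (1 - q / 2) ^+ (n - k.+1) <= expR (- (p / 4 * expR (eps * x))).
  apply: le_trans (_ : expR (- (q / 2)) ^+ (n - k.+1) <= _).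
    apply: lerXn2r; rewrite ?nnegrE ?expR_ge0 //; first by lra.
    exact: expR_ge1Dx.
  rewrite -expRM_natl ler_expR mulrN lerN2.
  apply: le_trans (_ : (n%:R / 2) * (p * expR (- ((1 - eps) * x)) / 2) <= _).
    rewrite nE; have -> : eps * x = x + - ((1 - eps) * x) by ring.
    by rewrite expRD le_eqVlt; apply/orP; left; apply/eqP; field.
  apply: ler_pM.
  - by rewrite divr_ge0.
  - by rewrite divr_ge0 // mulr_ge0 ?expR_ge0 // ltW.
  - exact: kn.
  - by rewrite ler_pM2r // invr_gt0.
apply: le_trans (_ : expR x * (expR L * expR (L * x)) *
   (expR r%:R * expR (- (p / 4 * expR (eps * x)))) <= _).
  apply: ler_pM; rewrite ?mulr_ge0 ?exprn_ge0 ?expR_ge0 //; first by lra.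
    rewrite ler_pM2l ?expR_gt0 //; apply: ler_pM => //; by rewrite exprn_ge0 ?expR_ge0.
  apply: ler_pM; rewrite ?exprn_ge0 //; lra.
rewrite -!expRD -[leRHS]lnK ?posrE // ler_expR.
have rB : r%:R <= (d1 + d1 ^+ 2) * (1 + x) ^+ 2.
  have DB : D%:R <= d1 * (1 + x).
    apply: le_trans DD _; rewrite /d1 /L.
    have -> : 2 * (x / c) / eps = 2 / (c * eps) * x by field; lra.
    have : 0 <= 2 / (c * eps) by rewrite divr_ge0 // ltW // mulr_gt0.
    set z := 2 / _ => z0; nra.
  have DB2 : D%:R * D%:R <= d1 ^+ 2 * (1 + x) ^+ 2.
    by rewrite -exprMn -expr2; apply: lerXn2r; rewrite ?nnegrE ?mulr_ge0 //; lra.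
  rewrite -rE natrD natrM mulrDl lerD //; apply: le_trans DB _.
  by rewrite ler_wpM2l //; nra.
have LB : L + L * x <= 2 / c * (1 + x) ^+ 2.
  rewrite /L; have -> : x / c + x / c * x = c^-1 * (x + x ^+ 2) by ring.
  have -> : 2 / c * (1 + x) ^+ 2 = c^-1 * (2 * (1 + x) ^+ 2) by ring.
  by rewrite ler_pM2l //; nra.
have xB : x <= (1 + x) ^+ 2 by nra.
have leN : - ln eps <= `|ln eps| by rewrite -normrN ler_norm.
have l1 : `|ln eps| <= `|ln eps| * (1 + x) ^+ 2.
  by rewrite ler_peMr //; nra.
have le1' : (a + `|ln eps|) * (1 + x) ^+ 2 <= p / 4 * expR (eps * x).
  have := ler_wpM2l (_ : 0 <= p / 4) le1; rewrite divr_ge0 ?(ltW p0) // => /(_ isT).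
  by have -> : p / 4 * ((a + `|ln eps|) * (4 / p) * (1 + x) ^+ 2) =
     (a + `|ln eps|) * (1 + x) ^+ 2 by field; lra.
exact: exponent_sum_le le1' rB LB xB leN l1.
Qed.

(** * The construction for the upper bound *)

Lemma sumr_card_const (R : realType) (I : finType) (B : R) : \sum_(x : I) B = #|I|%:R * B.
Proof. by rewrite sumr_const mulr_natl. Qed.

(** * The 5-cycle pattern and its clique number *)

Section Pattern.
Variables (m M K t : nat) (qs : seq {set 'I_m}).

Definition hub : finType := ('I_m + 'I_M * 'I_t + 'I_t * 'I_K * 'I_t)%type.
Definition hub1 (x : 'I_m) : hub := inl (inl x).
Definition hub2 (j : 'I_M) (i : 'I_t) : hub := inl (inr (j, i)).
Definition hub3 (i : 'I_t) (j : 'I_K) (l : 'I_t) : hub := inr (i, j, l).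

(* The label [inr true] stands for the typical non-hub vertices and [inr false] for the
   atypical ones. The parts are arranged in a 5-cycle: first hubs, typical vertices, third
   hubs, second hubs, atypical vertices. *)
Definition label_type : finType := (hub + bool)%type.

(** Each block of second or third hubs is a clique on [t] labels. A second hub is joined only to the
    third hubs of its own index [i], so a clique meeting both families contains a single second
    hub. *)
Definition patt (a b : label_type) : bool :=
  match a, b with
  | inl (inl (inl x)), inl (inl (inl y)) => shadow qs x y
  | inl (inl (inl _)), inr _ => true
  | inr _, inl (inl (inl _)) => true
  | inl (inl (inr (j, i))), inl (inl (inr (j', i'))) => (j == j') && (i != i')
  | inl (inr (i, j, l)), inl (inr (i', j', l')) => [&& i == i', j == j' & l != l']
  | inl (inl (inr (_, i))), inl (inr (i', _, _)) => i == i'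
  | inl (inr (i', _, _)), inl (inl (inr (_, i))) => i == i'
  | inl (inl (inr _)), inr b => ~~ b
  | inr b, inl (inl (inr _)) => ~~ b
  | inl (inr _), inr b => b
  | inr b, inl (inr _) => b
  | _, _ => false
  end.

Lemma patt_sym a b : patt a b = patt b a.
Proof.
case: a => [[[x|[j i]]|[[i j] l]]|a]; case: b => [[[y|[j' i']]|[[i' j'] l']]|b] //=.
- exact: shadow_sym.
- by rewrite eq_sym [i' == i]eq_sym.
- by rewrite eq_sym [j' == j]eq_sym [l' == l]eq_sym.
Qed.

Lemma patt_irr a : patt a a = false.
Proof.
case: a => [[[x|[j i]]|[[i j] l]]|a] //=; by rewrite ?/shadow ?eqxx ?andbF.
Qed.

Lemma card_le_inj_ord (T : finType) (W : {set T}) k (f : T -> 'I_k) :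
  {in W &, injective f} -> (#|W| <= k)%N.
Proof.
by move=> finj; rewrite -(card_in_imset finj) -[k in (_ <= k)%N]card_ord max_card.
Qed.

(** Three cases. A clique with a first hub has at most [t] first hubs, by [shadow_clique_le], and at
    most one outer label. With an outer label and no first hub, the rest lies in one of the other
    families and is separated by the position in the block. Otherwise [t.+1] colours separate the
    hubs. *)
Lemma patt_clique_le (W : {set label_type}) : (0 < t)%N -> tri_free qs ->
  {in qs, forall q : {set 'I_m}, #|q| <= t}%N ->
  {in W &, forall a b, a != b -> patt a b} -> (#|W| <= t.+1)%N.
Proof.
move=> t0 vq qt Wc.
have WcN a b : a \in W -> b \in W -> patt a b = false -> a = b.
  by move=> aW bW ab; apply/eqP; apply: contraFT ab; apply: Wc.
have [/existsP [x0 x0W]|/existsPn no1] := boolP [exists x, inl (hub1 x) \in W].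
  pose WX := [set x | inl (hub1 x) \in W].
  have WXt : (#|WX| <= t)%N.
    apply: (shadow_clique_le t0 vq qt) => x y; rewrite !inE => xW yW xy.
    by apply: (Wc (inl (hub1 x)) (inl (hub1 y))).
  pose WB := [set b | inr b \in W].
  have WB1 : (#|WB| <= 1)%N.
    apply/card_le1_eqP => b b'; rewrite !inE => bW bW'.
    by have := WcN _ _ bW bW' erefl => -[].
  apply: leq_trans (_ : #|[set inl (hub1 x) | x in WX] :|: [set inr b | b in WB]| <= _)%N.
    apply: subset_leq_card; apply/subsetP => a aW; apply/setUP.
    have := WcN _ _ aW x0W.
    case: a aW => [[[x|[j i]]|[[i j] l]]|b] aW.
    - by left; apply/imsetP; exists x; rewrite ?inE.
    - by move=> /(_ erefl).
    - by move=> /(_ erefl).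
    - by right; apply/imsetP; exists b; rewrite ?inE.
  apply: leq_trans (leq_card_setU _ _) _; rewrite -addn1; apply: leq_add.
    exact: leq_trans (leq_imset_card _ _) WXt.
  exact: leq_trans (leq_imset_card _ _) WB1.
have i0 : 'I_t by exists 0.
have [/existsP [b bW]|/existsPn noB] := boolP [exists b, inr b \in W].
  pose f (a : label_type) := match a with
    | inl (inl (inr (_, i))) => i | inl (inr (_, _, l)) => l | _ => i0 end.
  rewrite (cardsD1 (inr b)) bW add1n ltnS; apply: (@card_le_inj_ord _ _ _ f).
  move=> a a'; rewrite !in_setD1 => /andP[ab aW] /andP[a'b a'W] fE.
  apply/eqP; apply: contraT => aa'; exfalso.
  have pab := Wc _ _ aW bW ab; have pa'b := Wc _ _ a'W bW a'b.
  have paa := Wc _ _ aW a'W aa'; move: paa fE pab pa'b aW a'W {aa' ab a'b}.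
  case: a => [[[x|[j i]]|[[i j] l]]|c].
  - by move=> _ _ _ _ xW; have := no1 x; rewrite xW.
  - case: a' => [[[y|[j' i']]|[[i' j'] l']]|c'] //=.
    + by move=> /andP[_ /negP ii] fE; case: ii; rewrite fE.
    + by move=> _ _ /negPf ->.
  - case: a' => [[[y|[j' i']]|[[i' j'] l']]|c'] //=.
    + by move=> _ _ ->.
    + by move=> /and3P[_ _ /negP ll] fE; case: ll; rewrite fE.
  - by [].
(* A third hub of group [i] takes one of the [t] colours different from [i], hence never that of a
   second hub joined to it. *)
pose f (a : label_type) : 'I_t.+1 := match a with
  | inl (inl (inr (_, i))) => widen_ord (leqnSn t) i
  | inl (inr (i, _, l)) => lift (widen_ord (leqnSn t) i) l
  | _ => ord0 end.
apply: (@card_le_inj_ord _ _ _ f) => a a' aW a'W fE.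
apply/eqP; apply: contraT => aa'; exfalso.
have paa := Wc _ _ aW a'W aa'; move: paa fE aW a'W {aa'}.
case: a => [[[x|[j i]]|[[i j] l]]|c].
- by move=> _ _ xW; have := no1 x; rewrite xW.
- case: a' => [[[y|[j' i']]|[[i' j'] l']]|c'] //=.
  + by move=> /andP[_ /negP ii] /(congr1 val) /= /val_inj fE; case: ii; rewrite fE.
  + move=> /eqP -> fE; have := neq_lift (widen_ord (leqnSn t) i') l'.
    by rewrite -fE eqxx.
  + by move=> _ _ _ cW; have := noB c'; rewrite cW.
- case: a' => [[[y|[j' i']]|[[i' j'] l']]|c'] //=.
  + move=> /eqP -> fE; have := neq_lift (widen_ord (leqnSn t) i) l.
    by rewrite fE eqxx.
  + move=> /and3P[/eqP -> _ /negP ll] /lift_inj fE; case: ll; by rewrite fE.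
  + by move=> _ _ _ cW; have := noB c'; rewrite cW.
- by move=> _ _ cW; have := noB c; rewrite cW.
Qed.

End Pattern.

(** * Placing the pattern inside a graph and counting the edges *)

Section Construction.
Variables (R : realType) (T : finType) (m M K t : nat) (qs : seq {set 'I_m}).
Local Notation hub := (hub m M K t).
Local Notation patt := (@patt m M K t qs).
Variable enc : hub -> T.
Hypothesis enc_inj : injective enc.
Hypothesis t_gt0 : (0 < t)%N.
Hypothesis qs_tri_free : tri_free qs.
Hypothesis qs_card : {in qs, forall q : {set 'I_m}, #|q| = t}.
Variables (lo hi dm : R).
Implicit Types (Z : {set {set T}}) (u v : T) (Q : {set T}).

Definition outer : {set T} := ~: [set enc h | h : hub].
Definition first_nbrs Z v : {set 'I_m} := [set x | [set v; enc (hub1 M K t x)] \in Z].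
Definition typical Z v := lo <= #|first_nbrs Z v|%:R <= hi.

(** Hub labels are fixed in advance, while the type of any other vertex is read off from the
    graph. *)
Definition label Z v : label_type m M K t :=
  if [pick h | enc h == v] is Some h then inl h else inr (typical Z v).

Lemma label_enc Z h : label Z (enc h) = inl h.
Proof.
by rewrite /label; case: pickP => [h' /eqP /enc_inj -> //|/(_ h)]; rewrite eqxx.
Qed.

Lemma label_outer Z v : v \in outer -> label Z v = inr (typical Z v).
Proof.
rewrite inE => vo; rewrite /label; case: pickP => // h /eqP hv.
by case/negP: vo; rewrite -hv imset_f.
Qed.

Lemma outerP v : v \in outer \/ exists h, v = enc h.
Proof.
case: (boolP (v \in outer)); first by left.
by rewrite inE negbK => /imsetP[h _ ->]; right; exists h.
Qed.

Definition hub_edges Z : {set {set T}} :=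
  [set e in Z | [exists u, exists v, (e == [set u; v]) && patt (label Z u) (label Z v)]].
Definition hub_graph Z := graph_of_edges (hub_edges Z).

Lemma in_hub_graph Z u v : u != v ->
  ([set u; v] \in edges (hub_graph Z)) =
  ([set u; v] \in Z) && patt (label Z u) (label Z v).
Proof.
move=> uv; rewrite in_graph_of_edges edge_pair uv andbT in_set; congr (_ && _).
apply/existsP/idP => [[a /existsP [b /andP[/eqP E ab]]]|h]; last first.
  by exists u; apply/existsP; exists v; rewrite eqxx.
have : u \in [set a; b] by rewrite -E !inE eqxx.
have : v \in [set a; b] by rewrite -E !inE eqxx orbT.
rewrite !inE => /orP[/eqP va|/eqP vb] /orP[/eqP ua|/eqP ub].
- by rewrite ua va eqxx in uv.
- by rewrite patt_sym va ub.
- by rewrite ua vb.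
- by rewrite ub vb eqxx in uv.
Qed.

Lemma hub_graph_sub Z : edges (hub_graph Z) \subset edges (graph_of_edges Z).
Proof. by apply/subsetP => e; rewrite !in_graph_of_edges in_set => /andP[/andP[-> _] ->]. Qed.

(** The pattern is irreflexive, so a clique carries distinct labels, and these form a clique of the
    pattern. *)
Lemma hub_graph_no_copy Z : ~~ has_copy (hub_graph Z) (complete_graph t.+2).
Proof.
apply/has_copy_complete => -[W Wt /is_cliqueP Wc].
have inj : {in W &, injective (label Z)}.
  move=> u v uW vW lE; apply/eqP; apply: contraT => uv.
  by have := Wc u v uW vW uv; rewrite in_hub_graph // lE patt_irr andbF.
have := @patt_clique_le m M K t qs [set label Z w | w in W] t_gt0 qs_tri_free.
rewrite card_in_imset // Wt ltnn => h.
have // : false; apply: h => [q /qs_card -> //|_ _ /imsetP[u uW ->] /imsetP[v vW ->] luv].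
have uv : u != v by apply: contraNneq luv => ->.
by have := Wc u v uW vW uv; rewrite in_hub_graph // => /andP[].
Qed.

(** The pairs that must be present for [Q] with [u] and [v] to become a clique once the edge between
    [u] and [v] is added. *)
Definition cover_edges u v Q : {set {set T}} := pairs_in Q :|: (star u Q :|: star v Q).

Lemma hub_graph_cover Z u v (ls : {set hub}) : u != v -> #|ls| = t ->
  {in ls &, forall h h', h != h' -> patt (inl h) (inl h')} ->
  {in ls, forall h, patt (label Z u) (inl h)} ->
  {in ls, forall h, patt (label Z v) (inl h)} ->
  cover_edges u v [set enc h | h in ls] \subset Z ->
  has_copy (add_edge (hub_graph Z) [set u; v]) (complete_graph t.+2).
Proof.
move=> uv lst lc lu lv; rewrite !subUset => /and3P[cQ uQ vQ].
set Q := [set enc h | h in ls] in cQ uQ vQ.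
have Qt : #|Q| = t by rewrite card_imset.
have out w : {in ls, forall h, patt (label Z w) (inl h)} -> w \notin Q.
  move=> lw; apply/negP => /imsetP[h hl wE]; have := lw h hl.
  by rewrite wE label_enc patt_irr.
have adj w : {in ls, forall h, patt (label Z w) (inl h)} -> star w Q \subset Z ->
    {in Q, forall z, [set w; z] \in edges (hub_graph Z)}.
  move=> lw wQ z zQ; have wz : w != z by apply: contraNneq (out _ lw) => ->.
  rewrite in_hub_graph // (fintype.subsetP wQ) ?in_star //=.
  by case/imsetP: zQ => h hl ->; rewrite label_enc lw.
apply: (@has_copy_add_edge _ _ _ _ Q); rewrite ?out ?Qt //.
- apply/is_cliqueP => a b aQ bQ ab; rewrite in_hub_graph //.
  rewrite (fintype.subsetP cQ) /=; last first.
    by rewrite in_set edge_pair ab subUset !sub1set aQ bQ.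
  case/imsetP: aQ ab => h hl ->; case/imsetP: bQ => h' hl' -> hh.
  rewrite !label_enc; apply: lc => //; by apply: contraNneq hh => ->.
- exact: adj.
- exact: adj.
Qed.

Definition block2 (j : 'I_M) : {set T} := [set enc (hub2 m K j i) | i : 'I_t].
Definition block3 (i : 'I_t) (j : 'I_K) : {set T} := [set enc (hub3 m M i j l) | l : 'I_t].
Definition block1 (q : {set 'I_m}) : {set T} := [set enc (hub1 M K t x) | x in q].

Definition dense_cliques Z := [forall X : {set 'I_m}, (dm <= #|X|%:R) ==>
  has (fun q : {set 'I_m} => (q \subset X) && (pairs_in (block1 q) \subset Z)) qs].

(** The sets [bad0] to [bad3] collect the exceptions that are charged for separately. In [bad2] only
    the second vertex must have many first neighbours, so pairs of a typical and an atypical vertex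
    are included. *)
Definition bad0 Z : {set T} := [set v in outer | ~~ typical Z v].
Definition bad1 Z : {set ('I_M * 'I_t) * T} := [set x | (x.2 \in outer) &&
  ~~ [exists j, cover_edges (enc (hub2 m K x.1.1 x.1.2)) x.2 (block3 x.1.2 j) \subset Z]].
Definition bad2 Z : {set T * T} := [set x | [&& x.1 \in outer, x.2 \in outer, x.1 != x.2,
  lo <= #|first_nbrs Z x.2|%:R & #|first_nbrs Z x.1 :&: first_nbrs Z x.2|%:R < dm]].
Definition bad3 Z : {set T * T} := [set x | [&& x.1 \in outer, x.2 \in outer, x.1 != x.2 &
  ~~ [exists j, cover_edges x.1 x.2 (block2 j) \subset Z]]].

Lemma cover_by_first Z u v : dense_cliques Z -> u \in outer -> v \in outer -> u != v ->
  dm <= #|first_nbrs Z u :&: first_nbrs Z v|%:R ->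
  has_copy (add_edge (hub_graph Z) [set u; v]) (complete_graph t.+2).
Proof.
move=> /forallP/(_ (first_nbrs Z u :&: first_nbrs Z v))/implyP dc uo vo uv /dc.
case/hasP => q qin /andP[]; rewrite subsetI => /andP[qu qv] cq.
apply: (@hub_graph_cover _ _ _ [set hub1 M K t x | x in q]) => //.
- by rewrite card_imset ?qs_card // => x y [].
- move=> _ _ /imsetP[x xq ->] /imsetP[y yq ->] xy /=; apply/andP; split.
    by apply: contraNneq xy => ->.
  by apply/hasP; exists q; rewrite // xq.
- by move=> _ /imsetP[x xq ->]; rewrite label_outer.
- by move=> _ /imsetP[x xq ->]; rewrite label_outer.
- rewrite -imset_comp /= !subUset; apply/and3P; split; first exact: cq.
    apply/subsetP => _ /imsetP[_ /imsetP[x xq ->] ->].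
    by have := fintype.subsetP qu x xq; rewrite inE.
  apply/subsetP => _ /imsetP[_ /imsetP[x xq ->] ->].
  by have := fintype.subsetP qv x xq; rewrite inE.
Qed.

Lemma cover_by_second Z u v j : u \in outer -> v \in outer -> u != v ->
  ~~ typical Z u -> ~~ typical Z v -> cover_edges u v (block2 j) \subset Z ->
  has_copy (add_edge (hub_graph Z) [set u; v]) (complete_graph t.+2).
Proof.
move=> uo vo uv ut vt cov.
apply: (@hub_graph_cover _ _ _ [set hub2 m K j i | i : 'I_t]) => //.
- by rewrite card_imset ?card_ord // => i i' [].
- move=> _ _ /imsetP[i _ ->] /imsetP[i' _ ->] ii /=; rewrite eqxx /=.
  by apply: contraNneq ii => ->.
- by move=> _ /imsetP[i _ ->]; rewrite label_outer.
- by move=> _ /imsetP[i _ ->]; rewrite label_outer.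
- by rewrite -imset_comp.
Qed.

Lemma cover_by_third Z j i v j' : v \in outer -> typical Z v ->
  cover_edges (enc (hub2 m K j i)) v (block3 i j') \subset Z ->
  has_copy (add_edge (hub_graph Z) [set enc (hub2 m K j i); v]) (complete_graph t.+2).
Proof.
move=> vo vt cov.
apply: (@hub_graph_cover _ _ _ [set hub3 m M i j' l | l : 'I_t]) => //.
- by apply: contraTneq vo => <-; rewrite inE negbK imset_f.
- by rewrite card_imset ?card_ord // => l l' [].
- move=> _ _ /imsetP[l _ ->] /imsetP[l' _ ->] ll /=; rewrite !eqxx /=.
  by apply: contraNneq ll => ->.
- by move=> _ /imsetP[l _ ->]; rewrite label_enc /= eqxx.
- by move=> _ /imsetP[l _ ->]; rewrite label_outer.
- by rewrite -imset_comp.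
Qed.

(** Sorting by the labels of the two ends. An edge at a third hub, inside the hubs, or from an
    atypical vertex to a hub is simply counted; any other edge follows the pattern from a typical
    vertex to a first hub, or is uncovered because its covering block fails. *)
Lemma hub_graph_edge_cases Z e : dense_cliques Z ->
  e \in edges (hub_graph Z) :|: [set e in edges (graph_of_edges Z) |
     ~~ has_copy (add_edge (hub_graph Z) e) (complete_graph t.+2)] ->
  [\/ exists h h', e = [set enc h; enc h'],
      exists v x, [/\ v \in outer, typical Z v, x \in first_nbrs Z v &
        e = [set v; enc (hub1 M K t x)]],
      exists h v, v \in bad0 Z /\ e = [set enc h; v] |
      exists i j l v, e = [set enc (hub3 m M i j l); v]] \/
  [\/ exists x, x \in bad1 Z /\ e = [set enc (hub2 m K x.1.1 x.1.2); x.2],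
      exists x, x \in bad2 Z /\ e = [set x.1; x.2] |
      exists x, x \in bad3 Z /\ e = [set x.1; x.2]].
Proof.
move=> dc eH.
have eG : e \in edges (graph_of_edges Z).
  move: eH; rewrite in_setU => /orP[/(fintype.subsetP (hub_graph_sub Z)) //|].
  by rewrite in_set => /andP[].
have [u [v [uv eE]]] := edgeP eG.
have uvZ : [set u; v] \in Z by move: eG; rewrite eE in_graph_of_edges => /andP[].
have {eH} dich : patt (label Z u) (label Z v) \/
    ~~ has_copy (add_edge (hub_graph Z) [set u; v]) (complete_graph t.+2).
  move: eH; rewrite in_setU eE in_hub_graph // uvZ in_set => /orP[]; first by left.
  by case/andP => _; right.
(* An edge between a hub and an outer vertex, stated once for both orders of the ends. *)
have mixed h w : w \in outer -> [set enc h; w] \in Z ->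
    patt (inl h) (inr (typical Z w)) \/
    ~~ has_copy (add_edge (hub_graph Z) [set enc h; w]) (complete_graph t.+2) ->
    e = [set enc h; w] ->
  [\/ exists h h', e = [set enc h; enc h'],
      exists v x, [/\ v \in outer, typical Z v, x \in first_nbrs Z v &
        e = [set v; enc (hub1 M K t x)]],
      exists h v, v \in bad0 Z /\ e = [set enc h; v] |
      exists i j l v, e = [set enc (hub3 m M i j l); v]] \/
  [\/ exists x, x \in bad1 Z /\ e = [set enc (hub2 m K x.1.1 x.1.2); x.2],
      exists x, x \in bad2 Z /\ e = [set x.1; x.2] |
      exists x, x \in bad3 Z /\ e = [set x.1; x.2]].
  move=> wo hwZ dhw ehw.
  have [wt|wt] := boolP (typical Z w); last first.
    by left; apply: Or43; exists h, w; rewrite in_set wo.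
  case: h hwZ dhw ehw => [[x|[j i]]|[[i j] l]] hwZ dhw ehw.
  - by left; apply: Or42; exists w, x; split; rewrite // ?in_set setUC.
  - right; apply: Or31; exists ((j, i), w); split => //.
    rewrite in_set /= wo; apply/existsPn => j'; apply/negP => cov.
    have hc := cover_by_third wo wt cov.
    by case: dhw; rewrite /= ?wt // hc.
  - by left; apply: Or44; exists i, j, l, w.
have [uo|[h uE]] := outerP u; have [vo|[h' vE]] := outerP v.
- rewrite !label_outer // /= in dich; case: dich => // nc; right.
  (* An uncovered pair with a typical end must have too few common first neighbours. *)
  have far a b : a \in outer -> b \in outer -> a != b -> typical Z b ->
      ~~ has_copy (add_edge (hub_graph Z) [set a; b]) (complete_graph t.+2) ->
      (a, b) \in bad2 Z.
    move=> ao bo ab /andP[bt _] nab; rewrite in_set /= ao bo ab bt ltNge /=.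
    by apply: contra nab; apply: cover_by_first.
  have [vt|vt] := boolP (typical Z v).
    by apply: Or32; exists (u, v); split => //; apply: far.
  have [ut|ut] := boolP (typical Z u).
    apply: Or32; exists (v, u); split; last by rewrite eE setUC.
    by apply: far => //; [rewrite eq_sym|rewrite setUC].
  apply: Or33; exists (u, v); split => //; rewrite in_set /= uo vo uv /=.
  by apply: contra nc => /existsP [j]; apply: cover_by_second.
- have vuE : e = [set enc h'; u] by rewrite eE vE setUC.
  apply: (mixed h' u uo _ _ vuE); first by rewrite -vuE eE.
  have lv : label Z v = inl h' by rewrite vE label_enc.
  by move: dich; rewrite lv label_outer // patt_sym -eE vuE.
- have uvE : e = [set enc h; v] by rewrite eE uE.
  apply: (mixed h v vo _ _ uvE); first by rewrite -uvE eE.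
  have lu : label Z u = inl h by rewrite uE label_enc.
  by move: dich; rewrite lu label_outer // -eE uvE.
- by left; apply: Or41; exists h, h'; rewrite -uE -vE.
Qed.

(** The main term [#|T|%:R * hi] counts the edges from typical vertices to first hubs; the last
    bracket holds the exceptions, to be bounded in mean. *)
Lemma sat_hub_graph_le Z : 0 <= hi -> dense_cliques Z ->
  (sat (graph_of_edges Z) (complete_graph t.+2))%:R <=
  (#|hub| * #|hub|)%:R + #|T|%:R * hi + (t * K * t * #|T|)%:R +
  (#|hub|%:R * #|bad0 Z|%:R + #|bad1 Z|%:R + #|bad2 Z|%:R + #|bad3 Z|%:R) :> R.
Proof.
move=> hi0 dc.
pose P2 := [set x : T * 'I_m | [&& x.1 \in outer, typical Z x.1 & x.2 \in first_nbrs Z x.1]].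
pose S1 := [set [set enc x.1; enc x.2] | x : hub * hub].
pose S2 := [set [set x.1; enc (hub1 M K t x.2)] | x in P2].
pose S3 := [set [set enc x.1; x.2] | x in setX [set: hub] (bad0 Z)].
pose S4 := [set [set enc (hub3 m M x.1.1.1 x.1.1.2 x.1.2); x.2] | x : ('I_t * 'I_K * 'I_t) * T].
pose S5 := [set [set enc (hub2 m K x.1.1 x.1.2); x.2] | x in bad1 Z].
pose S6 := [set [set x.1; x.2] | x in bad2 Z].
pose S7 := [set [set x.1; x.2] | x in bad3 Z].
have satS : (sat (graph_of_edges Z) (complete_graph t.+2) <=
    #|S1 :|: S2 :|: S4 :|: (S3 :|: S5 :|: S6 :|: S7)|)%N.
  apply: leq_trans (sat_le_uncovered (hub_graph_sub Z) (hub_graph_no_copy Z)) _.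
  apply: subset_leq_card; apply/subsetP => e /(hub_graph_edge_cases dc) H; rewrite !in_setU.
  case: H => [[[h [h' ->]]|[v [x [vo vt xv ->]]]|[h [v [vb ->]]]|[i [j [l [v ->]]]]]|
              [[x [xb ->]]|[x [xb ->]]|[x [xb ->]]]].
  - have -> : [set enc h; enc h'] \in S1 by apply/imsetP; exists (h, h').
    by [].
  - have -> : [set v; enc (hub1 M K t x)] \in S2.
      by apply/imsetP; exists (v, x); rewrite // in_set /= vo vt.
    by rewrite ?orbT.
  - have -> : [set enc h; v] \in S3 by apply/imsetP; exists (h, v); rewrite // in_setX in_setT.
    by rewrite ?orbT.
  - have -> : [set enc (hub3 m M i j l); v] \in S4 by apply/imsetP; exists ((i, j, l), v).
    by rewrite ?orbT.
  - have -> : [set enc (hub2 m K x.1.1 x.1.2); x.2] \in S5 by apply/imsetP; exists x.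
    by rewrite ?orbT.
  - have -> : [set x.1; x.2] \in S6 by apply/imsetP; exists x.
    by rewrite ?orbT.
  - have -> : [set x.1; x.2] \in S7 by apply/imsetP; exists x.
    by rewrite ?orbT.
have P2le : #|P2|%:R <= #|T|%:R * hi.
  have -> : #|P2| = (\sum_v \sum_x ((v, x) \in P2))%N.
    rewrite pair_bigA -sum1_card big_mkcond; apply: eq_bigr => -[v x] _ /=.
    by case: (_ \in _).
  rewrite natr_sum -sumr_card_const; apply: ler_sum => v _.
  have [/andP[_ vhi]|nv] := boolP ((v \in outer) && typical Z v); last first.
    rewrite big1 // => x _; apply/eqP; rewrite eqb0 in_set /= andbA.
    by rewrite (negPf nv).
  case/andP: vhi => _ vhi; apply: le_trans vhi; rewrite ler_nat -sum1_card [leqRHS]big_mkcond /=.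
  apply: leq_sum => x _; rewrite in_set /=.
  by case: (x \in first_nbrs Z v); rewrite ?andbF // leq_b1.
have cS1 : (#|S1| <= #|hub| * #|hub|)%N.
  by apply: leq_trans (leq_imset_card _ _) _; rewrite card_prod.
have cS2 : (#|S2| <= #|P2|)%N by apply: leq_imset_card.
have cS3 : (#|S3| <= #|hub| * #|bad0 Z|)%N.
  by apply: leq_trans (leq_imset_card _ _) _; rewrite cardsX cardsT.
have cS4 : (#|S4| <= t * K * t * #|T|)%N.
  by apply: leq_trans (leq_imset_card _ _) _; rewrite !card_prod !card_ord.
have cS5 : (#|S5| <= #|bad1 Z|)%N by apply: leq_imset_card.
have cS6 : (#|S6| <= #|bad2 Z|)%N by apply: leq_imset_card.
have cS7 : (#|S7| <= #|bad3 Z|)%N by apply: leq_imset_card.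
apply: le_trans (_ : (#|hub| * #|hub| + #|P2| + t * K * t * #|T| +
    (#|hub| * #|bad0 Z| + #|bad1 Z| + #|bad2 Z| + #|bad3 Z|))%N%:R <= _).
  rewrite ler_nat; apply: leq_trans satS _.
  have cU (A B : {set {set T}}) a b : (#|A| <= a -> #|B| <= b -> #|A :|: B| <= a + b)%N.
    by move=> Aa Bb; apply: leq_trans (leq_card_setU _ _) _; apply: leq_add.
  exact: (cU _ _ _ _ (cU _ _ _ _ (cU _ _ _ _ cS1 cS2) cS4)
    (cU _ _ _ _ (cU _ _ _ _ (cU _ _ _ _ cS3 cS5) cS6) cS7)).
by rewrite !natrD !natrM !lerD2r lerD2l.
Qed.

End Construction.

(** * Probability estimates for the construction *)

Section Estimates.
Variables (R : realType) (p : R).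
Hypotheses (p_ge0 : 0 <= p) (p_le1 : p <= 1).

Lemma Pr_none_subset_le (T : finType) (Es : seq {set T}) d :
  pairwise (fun X Y : {set T} => [disjoint X & Y]) Es ->
  {in Es, forall X : {set T}, #|X| <= d}%N ->
  Pr p (fun Z => all (fun X : {set T} => ~~ (X \subset Z)) Es) <= (1 - p ^+ d) ^+ size Es.
Proof.
move=> dis Ed; rewrite Pr_none_subset //; elim: Es {dis} Ed => [|X Es IH] Ed.
  by rewrite big_nil expr0.
rewrite big_cons exprS; apply: ler_pM.
- by rewrite subr_ge0 exprn_ile1.
- by apply: prodr_ge0 => Y _; rewrite subr_ge0 exprn_ile1.
- by rewrite lerD2l lerN2 ler_wiXn2l // Ed ?mem_head.
- by apply: IH => Y YE; apply: Ed; rewrite inE YE orbT.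
Qed.

Lemma Ex_card_le (T I : finType) (S : {set T} -> {set I}) (B : R) :
  (forall x, Pr p (fun Z => x \in S Z) <= B) -> Ex p (fun Z => #|S Z|%:R) <= #|I|%:R * B.
Proof.
move=> SB; rewrite (@eq_Ex _ _ _ _ (fun Z => \sum_x (x \in S Z)%:R)).
  by rewrite Ex_sum -sumr_card_const; apply: ler_sum => x _; apply: SB.
move=> Z; rewrite -sum1_card natr_sum big_mkcond; apply: eq_bigr => x _.
by case: (x \in S Z).
Qed.

Lemma cover_edges_sub (T : finType) (u v : T) (Q : {set T}) e : e \in cover_edges u v Q ->
  e \subset u |: (v |: Q) /\ exists2 a, a \in Q & a \in e.
Proof.
rewrite !in_setU => /or3P[|/imsetP[w wQ ->]|/imsetP[w wQ ->]].
- rewrite 2!in_set => /andP[/cards2P [a [b [_ ->]]]]; rewrite !subUset !sub1set.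
  case/andP => aQ bQ; rewrite !in_setU1 aQ bQ !orbT; split => //.
  by exists a; rewrite ?inE ?eqxx.
- by rewrite subUset !sub1set !inE eqxx wQ !orbT; split => //; exists w; rewrite ?inE ?eqxx ?orbT.
- by rewrite subUset !sub1set !inE eqxx wQ !orbT; split => //; exists w; rewrite ?inE ?eqxx ?orbT.
Qed.

Lemma pairs_card_le (T : finType) (W : {set T}) (E : {set {set T}}) :
  E \subset vpairs T -> {in E, forall e : {set T}, e \subset W} -> (#|E| <= #|W| * #|W|)%N.
Proof.
move=> Ev EW; apply: leq_trans (_ : #|[set [set x.1; x.2] | x in setX W W]| <= _)%N.
  apply: subset_leq_card; apply/subsetP => e eE.
  have := fintype.subsetP Ev e eE; have := EW e eE; rewrite in_set => eW /cards2P [a [b [_ ab]]].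
  move: eW; rewrite ab subUset !sub1set => /andP[aW bW].
  by apply/imsetP; exists (a, b); rewrite // in_setX aW.
by apply: leq_trans (leq_imset_card _ _) _; rewrite cardsX.
Qed.

Lemma card_cover_edges (T : finType) (u v : T) (Q : {set T}) : u \notin Q -> v \notin Q ->
  (#|cover_edges u v Q| <= #|Q|.+2 * #|Q|.+2)%N.
Proof.
move=> uQ vQ; apply: leq_trans (_ : #|u |: (v |: Q)| * #|u |: (v |: Q)| <= _)%N.
  apply: pairs_card_le; last by move=> e /cover_edges_sub [].
  apply/subsetP => e; rewrite !in_setU => /or3P[|/imsetP[w wQ ->]|/imsetP[w wQ ->]].
  - by rewrite in_set => /andP[].
  - by rewrite edge_pair; apply: contraNneq uQ => ->.
  - by rewrite edge_pair; apply: contraNneq vQ => ->.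
by apply: leq_mul; rewrite !cardsU1; case: (_ \notin _); case: (_ \notin _);
  rewrite /= ?add0n ?add1n // ltnW.
Qed.

(** Every pair used to cover by [Q j] meets [Q j] and stays inside [Q j] with [u] and [v], so
    disjoint blocks give independent attempts. *)
Lemma Pr_no_cover (T I : finType) (Q : I -> {set T}) t u v :
  (forall j, #|Q j| = t) -> (forall i j, i != j -> [disjoint Q i & Q j]) ->
  (forall j, u \notin Q j) -> (forall j, v \notin Q j) ->
  Pr p (fun Z => ~~ [exists j, cover_edges u v (Q j) \subset Z]) <=
  (1 - p ^+ (t.+2 * t.+2)) ^+ #|I|.
Proof.
move=> Qt Qd uQ vQ; pose Es := [seq cover_edges u v (Q j) | j <- enum I].
have -> : #|I| = size Es by rewrite size_map -cardE.
apply: le_trans (@Pr_none_subset_le _ Es (t.+2 * t.+2) _ _).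
- apply: le_Pr => // Z /existsPn h; apply/allP => _ /mapP[j _ ->]; exact: h.
- rewrite pairwise_map.
  have : pairwise (fun i j : I => i != j) (enum I) by rewrite -uniq_pairwise enum_uniq.
  apply: sub_pairwise => i j ij /=; rewrite -setI_eq0; apply/set0Pn => -[e /setIP[ei ej]].
  have [_ [a aQ ae]] := cover_edges_sub ei; have [eW _] := cover_edges_sub ej.
  have := fintype.subsetP eW a ae; rewrite !in_setU1 => /or3P[/eqP au|/eqP av|aj].
  + by rewrite au (negPf (uQ i)) in aQ.
  + by rewrite av (negPf (vQ i)) in aQ.
  + by rewrite (disjointFr (Qd _ _ ij) aQ) in aj.
- by move=> _ /mapP[j _ ->]; apply: leq_trans (card_cover_edges (uQ j) (vQ j)) _; rewrite Qt.
Qed.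

Lemma Ex_pair_cov (T : finType) (e e' : T) :
  Ex p (fun Z => ((e \in Z)%:R - p) * ((e' \in Z)%:R - p)) =
  if e == e' then p * (1 - p) else 0.
Proof.
rewrite (@eq_Ex _ _ _ _ (fun Z => ([set e; e'] \subset Z)%:R + (- p * ([set e] \subset Z)%:R +
  (- p * ([set e'] \subset Z)%:R + p * p)))); last first.
  move=> Z; rewrite subUset !sub1set; case: (e \in Z); case: (e' \in Z) => /=; ring.
rewrite !ExD !ExZ Ex_cst -!/(Pr p _) !Pr_subset !cards1 expr1 cards2.
by case: eqP => _ /=; rewrite ?expr1 ?expr2; ring.
Qed.

(** Second moment: the covariances of distinct elements vanish, and each variance is at most 1. *)
Lemma Pr_chebyshev (T I : finType) (E : I -> T) (d : R) : injective E -> 0 < d ->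
  Pr p (fun Z => ~~ (p * #|I|%:R - d <= #|[set x | E x \in Z]|%:R <= p * #|I|%:R + d)) <=
  #|I|%:R / d ^+ 2.
Proof.
move=> Einj d0.
pose f (Z : {set T}) : R := \sum_x \sum_y ((E x \in Z)%:R - p) * ((E y \in Z)%:R - p).
have fE Z : f Z = (#|[set x | E x \in Z]|%:R - p * #|I|%:R) ^+ 2.
  have -> : #|[set x | E x \in Z]|%:R - p * #|I|%:R = \sum_x ((E x \in Z)%:R - p).
    rewrite sumrB sumr_const mulr_natr; congr (_ - _).
    rewrite -sum1_card natr_sum big_mkcond; apply: eq_bigr => x _; rewrite inE.
    by case: (_ \in _).
  rewrite expr2 /f mulr_suml; apply: eq_bigr => x _; by rewrite mulr_sumr.
apply: le_trans (_ : Ex p f / d ^+ 2 <= _).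
  apply: Ex_markov => //; first by rewrite exprn_gt0.
    by move=> Z; rewrite fE sqr_ge0.
  move=> Z; rewrite fE; set z := #|_|%:R; set y := p * _.
  by rewrite negb_and -!ltNge => /orP[h|h]; nra.
rewrite ler_pM2r ?invr_gt0 ?exprn_gt0 // /f Ex_sum.
rewrite -[leRHS]mulr1 -sumr_card_const; apply: ler_sum => x _; rewrite Ex_sum.
under eq_bigr do rewrite Ex_pair_cov (inj_eq Einj).
rewrite (bigD1 x) //= eqxx big1 ?addr0 => [|y yx]; last by rewrite eq_sym (negPf yx).
nra.
Qed.

(* The weights make each factor have mean 1. *)
Lemma Pr_small_common (T I : finType) (E E' : I -> T) (a b lo dm : R) :
  injective E -> injective E' -> (forall x y, E x != E' y) ->
  0 <= a -> 0 <= b -> expR (- b) = 1 - p + p * expR (- a) ->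
  Pr p (fun Z => (lo <= #|[set x | E x \in Z]|%:R) &&
     (#|[set x | E' x \in Z] :&: [set x | E x \in Z]|%:R < dm)) <=
  expR (a * dm - b * lo).
Proof.
move=> Einj E'inj EE' a0 b0 abE.
(* This is the exponential weight [FE], expanded in inclusion indicators so that its mean follows
   from [Pr_subset]. *)
pose F x (Z : {set T}) : R :=
  1 + ((expR b - 1) * ([set E x] \subset Z)%:R +
       expR b * (expR (- a) - 1) * ([set E x; E' x] \subset Z)%:R).
have FE x Z : F x Z = expR (b * (E x \in Z)%:R - a * ((E' x \in Z) && (E x \in Z))%:R).
  rewrite /F subUset !sub1set; case: (E x \in Z); case: (E' x \in Z);
    rewrite /= !(mulr1, mulr0, subr0, expR0) ?expRD; ring.
have EF x : Ex p (F x) = 1.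
  rewrite !ExD !ExZ Ex_cst -!/(Pr p _) !Pr_subset cards1 cards2 EE' expr1.
  have : expR b * expR (- b) = 1 by rewrite -expRD subrr expR0.
  rewrite abE => h.
  transitivity (1 + p * (expR b * (1 - p + p * expR (- a)) - 1)); first by ring.
  by rewrite h subrr mulr0 addr0.
have EP : Ex p (fun Z => \prod_(x in [set: I]) F x Z) = 1.
  rewrite (@Ex_prod_set _ _ _ _ _ (fun x => [set E x; E' x])).
  - by rewrite big1.
  - by move=> x Z; rewrite !FE !in_setI set21 set22 !andbT.
  - move=> x y _ _ xy; rewrite -setI_eq0; apply/set0Pn => -[e]; rewrite !inE.
    case/andP => /orP[/eqP -> |/eqP ->] /orP[/eqP h|/eqP h].
    + by rewrite (Einj _ _ h) eqxx in xy.
    + by have := EE' x y; rewrite h eqxx.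
    + by have := EE' y x; rewrite h eqxx.
    + by rewrite (E'inj _ _ h) eqxx in xy.
apply: le_trans (_ : Ex p (fun Z => \prod_(x in [set: I]) F x Z) / expR (b * lo - a * dm) <= _).
  apply: Ex_markov => //; first exact: expR_gt0.
    by move=> Z; apply: prodr_ge0 => x _; rewrite FE expR_ge0.
  move=> Z /andP[h1 h2]; under eq_bigr do rewrite FE.
  rewrite -expR_sum ler_expR sumrB -!mulr_sumr.
  have bigT (G : I -> R) : \sum_(x in [set: I]) G x = \sum_x G x.
    by apply: eq_bigl => x; rewrite in_setT.
  have -> : \sum_(x in [set: I]) (E x \in Z)%:R = #|[set x | E x \in Z]|%:R :> R.
    rewrite -sum1_card natr_sum [RHS]big_mkcond bigT; apply: eq_bigr => x _; rewrite inE.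
    by case: (_ \in _).
  have -> : \sum_(x in [set: I]) ((E' x \in Z) && (E x \in Z))%:R =
      #|[set x | E' x \in Z] :&: [set x | E x \in Z]|%:R :> R.
    rewrite -sum1_card natr_sum [RHS]big_mkcond bigT; apply: eq_bigr => x _; rewrite !inE.
    by case: (_ && _).
  by apply: lerB; apply: ler_wpM2l => //; apply: ltW.
by rewrite EP mul1r -expRN opprB.
Qed.

End Estimates.

(** * Expected number of exceptions in the construction *)

Section HubEstimates.
Variables (R : realType) (p : R).
Hypotheses (p_ge0 : 0 <= p) (p_le1 : p <= 1).
Variables (T : finType) (m M K t : nat) (qs : seq {set 'I_m}).
Local Notation hub := (hub m M K t).
Variable enc : hub -> T.
Hypothesis enc_inj : injective enc.

Lemma Pr_cond_le (c : bool) (A : pred {set {set T}}) (B : R) :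
  0 <= B -> (c -> Pr p A <= B) -> Pr p (fun Z => c && A Z) <= B.
Proof.
case: c => B0 h; first exact: h.
by rewrite /Pr (@eq_Ex _ _ _ _ (fun=> 0)) // Ex_cst.
Qed.

(** Union bound over at most [2 ^+ m] sets [X]; the hyperedges inside one [X] use disjoint sets of
    pairs, so their failures to span a clique are independent. *)
Lemma Pr_not_dense (dm : R) N : tri_free qs -> {in qs, forall q : {set 'I_m}, #|q| = t} ->
  (forall X : {set 'I_m}, dm <= #|X|%:R ->
    (N <= count (fun q : {set 'I_m} => q \subset X) qs)%N) ->
  Pr p (fun Z => ~~ dense_cliques qs enc dm Z) <= 2 ^+ m * (1 - p ^+ (t * t)) ^+ N.
Proof.
move=> vq qt Nq.
pose blocks (X : {set 'I_m}) := [seq pairs_in (block1 enc q) |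
  q <- [seq q : {set 'I_m} <- qs | q \subset X]].
apply: le_trans (_ : Pr p (fun Z => [exists X : {set 'I_m} in
    [pred X : {set 'I_m} | dm <= #|X|%:R],
    all (fun E : {set {set T}} => ~~ (E \subset Z)) (blocks X)]) <= _).
  apply: le_Pr => // Z /forallPn [X]; rewrite negb_imply => /andP[dX /hasPn nq].
  apply/exists_inP; exists X => //; apply/allP => _ /mapP[q qX ->].
  move: qX; rewrite mem_filter => /andP[qX qin].
  by have := nq q qin; rewrite qX.
have B0 : 0 <= 1 - p ^+ (t * t) by rewrite subr_ge0 exprn_ile1.
apply: le_trans (Pr_exists p_ge0 p_le1 _ _) _.
apply: le_trans (_ : \sum_(X : {set 'I_m} | X \in [pred X : {set 'I_m} | dm <= #|X|%:R])
    (1 - p ^+ (t * t)) ^+ N <= _); last first.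
  rewrite sumr_const -[leLHS]mulr_natl ler_wpM2r ?exprn_ge0 //.
  rewrite -natrX ler_nat -[m in (2 ^ m)%N]card_ord -cardsT -card_powerset.
  by apply: subset_leq_card; apply/subsetP => Y _; rewrite powersetE subsetT.
apply: ler_sum => X; rewrite inE => dX.
apply: le_trans (_ : (1 - p ^+ (t * t)) ^+ size (blocks X) <= _); last first.
  apply: ler_wiXn2l => //; first by rewrite lerBlDr lerDl exprn_ge0.
  by rewrite size_map size_filter; apply: Nq.
have h1inj : injective (fun x => enc (hub1 M K t x)) by move=> x y /enc_inj [].
apply: Pr_none_subset_le => //.
- rewrite pairwise_map; apply: pairwise_filter.
  apply: sub_pairwise (tri_free_pairs_disjoint vq) => q q' /= dq.
  rewrite -setI_eq0; apply/set0Pn => -[e]; rewrite in_setI 2!in_set.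
  case/andP => /andP[/cards2P [a [b [ab ->]]]]; rewrite in_set !subUset !sub1set.
  case/andP => /imsetP[x xq aE] /imsetP[y yq bE].
  case/and3P => _ /imsetP[x' xq' aE'] /imsetP[y' yq' bE'].
  have xx : x = x' by apply: h1inj; rewrite -aE -aE'.
  have yy : y = y' by apply: h1inj; rewrite -bE -bE'.
  have xy : x != y by apply: contraNneq ab => xy; rewrite aE bE xy.
  have inP (r : {set 'I_m}) : x \in r -> y \in r -> [set x; y] \in pairs_in r.
    by move=> xr yr; rewrite in_set edge_pair xy subUset !sub1set xr yr.
  by have := disjointFr dq (inP q xq yq); rewrite inP // ?xx ?yy.
- move=> _ /mapP[q qX ->]; move: qX; rewrite mem_filter => /andP[_ qin].
  have -> : (t * t = #|block1 enc q| * #|block1 enc q|)%N.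
    by rewrite card_imset // qt.
  apply: pairs_card_le => [|e]; last by rewrite in_set => /andP[].
  by apply/subsetP => e; rewrite in_set => /andP[].
Qed.

Let nbr_edge v x := [set v; enc (hub1 M K t x)].

Lemma nbr_edge_inj v : injective (nbr_edge v).
Proof. by move=> x y /set2_inj /enc_inj []. Qed.

Lemma enc_not_outer h : (enc h \in outer enc) = false.
Proof. by rewrite inE imset_f. Qed.

Lemma Ex_bad0 (d : R) : 0 < d ->
  Ex p (fun Z => #|bad0 enc (p * m%:R - d) (p * m%:R + d) Z|%:R) <=
    #|T|%:R * (m%:R / d ^+ 2).
Proof.
move=> d0; apply: Ex_card_le => v.
apply: le_trans (_ : Pr p (fun Z => (v \in outer enc) &&
   ~~ (p * m%:R - d <= #|[set x | nbr_edge v x \in Z]|%:R <= p * m%:R + d)) <= _).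
  by apply: le_Pr => // Z; rewrite in_set.
apply: Pr_cond_le => [|_]; first by rewrite divr_ge0 // exprn_ge0 // ltW.
have := @Pr_chebyshev R p p_ge0 p_le1 _ 'I_m (nbr_edge v) d (@nbr_edge_inj v) d0.
by rewrite card_ord.
Qed.

Lemma Ex_bad1 : Ex p (fun Z => #|bad1 enc Z|%:R) <=
    (M * t * #|T|)%:R * (1 - p ^+ (t.+2 * t.+2)) ^+ K.
Proof.
have -> : (M * t * #|T|)%N = #|{: 'I_M * 'I_t * T}| by rewrite !card_prod !card_ord.
apply: Ex_card_le => -[[j i] v].
apply: le_trans (_ : Pr p (fun Z => (v \in outer enc) &&
   ~~ [exists j', cover_edges (enc (hub2 m K j i)) v (block3 enc i j') \subset Z]) <= _).
  by apply: le_Pr => // Z; rewrite in_set.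
apply: Pr_cond_le => [|vo]; first by rewrite exprn_ge0 // subr_ge0 exprn_ile1.
rewrite -[K in _ ^+ K]card_ord; apply: Pr_no_cover => //.
- by move=> j'; rewrite card_imset ?card_ord // => l l' /enc_inj [].
- move=> j1 j2 jj; rewrite -setI_eq0; apply/set0Pn => -[w /setIP[]].
  by case/imsetP => l _ -> /imsetP[l' _ /enc_inj [E _]]; rewrite E eqxx in jj.
- by move=> j'; apply/negP => /imsetP[l _ /enc_inj].
- by move=> j'; apply/negP => /imsetP[l _ vE]; rewrite vE enc_not_outer in vo.
Qed.

Lemma Ex_bad2 (lo dm a b : R) :
  0 <= a -> 0 <= b -> expR (- b) = 1 - p + p * expR (- a) ->
  Ex p (fun Z => #|bad2 enc lo dm Z|%:R) <= (#|T| * #|T|)%:R * expR (a * dm - b * lo).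
Proof.
move=> a0 b0 ab.
have -> : (#|T| * #|T|)%N = #|{: T * T}| by rewrite card_prod.
apply: Ex_card_le => -[u v].
apply: le_trans (_ : Pr p (fun Z => [&& u \in outer enc, v \in outer enc & u != v] &&
  ((lo <= #|[set x | nbr_edge v x \in Z]|%:R) &&
     (#|[set x | nbr_edge u x \in Z] :&: [set x | nbr_edge v x \in Z]|%:R < dm))) <= _).
  by apply: le_Pr => // Z; rewrite in_set /= => /and5P[-> -> -> -> ->].
apply: Pr_cond_le; first exact: expR_ge0.
case/and3P => uo vo uv; apply: Pr_small_common => //; try exact: nbr_edge_inj.
move=> x y; apply/negP => /eqP E.
have : v \in nbr_edge u y by rewrite -E !inE eqxx.
rewrite !inE eq_sym (negPf uv) => /eqP vE; by rewrite vE enc_not_outer in vo.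
Qed.

Lemma Ex_bad3 : Ex p (fun Z => #|bad3 enc Z|%:R) <=
    (#|T| * #|T|)%:R * (1 - p ^+ (t.+2 * t.+2)) ^+ M.
Proof.
have -> : (#|T| * #|T|)%N = #|{: T * T}| by rewrite card_prod.
apply: Ex_card_le => -[u v].
apply: le_trans (_ : Pr p (fun Z => [&& u \in outer enc, v \in outer enc & u != v] &&
   ~~ [exists j, cover_edges u v (block2 enc j) \subset Z]) <= _).
  by apply: le_Pr => // Z; rewrite in_set /= => /and4P[-> -> -> ->].
apply: Pr_cond_le; first by rewrite exprn_ge0 // subr_ge0 exprn_ile1.
case/and3P => uo vo uv; rewrite -[M in _ ^+ M]card_ord; apply: Pr_no_cover => //.
- by move=> j'; rewrite card_imset ?card_ord // => l l' /enc_inj [].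
- move=> j1 j2 jj; rewrite -setI_eq0; apply/set0Pn => -[w /setIP[]].
  by case/imsetP => l _ -> /imsetP[l' _ /enc_inj [E _]]; rewrite E eqxx in jj.
- by move=> j'; apply/negP => /imsetP[l _ uE]; rewrite uE enc_not_outer in uo.
- by move=> j'; apply/negP => /imsetP[l _ vE]; rewrite vE enc_not_outer in vo.
Qed.

(** [y] is the allowance for exceptions: exceeding [x] forces either the failure of [dense_cliques]
    or more exceptions than allowed, and the latter is bounded by Markov's inequality. *)
Lemma Pr_sat_gt_hub (d dm a b x y : R) N : (0 < t)%N -> tri_free qs ->
  {in qs, forall q : {set 'I_m}, #|q| = t} ->
  (forall X : {set 'I_m}, dm <= #|X|%:R ->
    (N <= count (fun q : {set 'I_m} => q \subset X) qs)%N) ->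
  0 < d -> 0 <= a -> 0 <= b -> expR (- b) = 1 - p + p * expR (- a) -> 0 < y ->
  (#|hub| * #|hub|)%:R + #|T|%:R * (p * m%:R + d) + (t * K * t * #|T|)%:R + y <= x ->
  Pr p (fun Z : {set {set T}} => x < (sat (graph_of_edges Z) (complete_graph t.+2))%:R) <=
  2 ^+ m * (1 - p ^+ (t * t)) ^+ N +
  (#|hub|%:R * (#|T|%:R * (m%:R / d ^+ 2)) +
   (M * t * #|T|)%:R * (1 - p ^+ (t.+2 * t.+2)) ^+ K +
   (#|T| * #|T|)%:R * expR (a * dm - b * (p * m%:R - d)) +
   (#|T| * #|T|)%:R * (1 - p ^+ (t.+2 * t.+2)) ^+ M) / y.
Proof.
move=> t0 vq qt Nq d0 a0 b0 abE y0 xle.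
set lo := p * m%:R - d; set hi := p * m%:R + d.
pose Y Z : R := #|hub|%:R * #|bad0 enc lo hi Z|%:R + #|bad1 enc Z|%:R +
  #|bad2 enc lo dm Z|%:R + #|bad3 enc Z|%:R.
apply: le_trans (_ : Pr p (fun Z => ~~ dense_cliques qs enc dm Z || (y <= Y Z)) <= _).
  apply: le_Pr => // Z xs; case: (boolP (dense_cliques _ _ _ _)) => //= dc.
  have hi0 : 0 <= hi by rewrite addr_ge0 ?mulr_ge0 // ltW.
  have := sat_hub_graph_le enc_inj t0 vq qt lo hi0 dc.
  rewrite -/(Y Z) => le_s; have := lt_le_trans xs le_s.
  move: xle; rewrite -/hi; set A := _ + _ + _ => xle h.
  have := le_lt_trans xle h; rewrite ltrD2l; exact: ltW.
apply: le_trans (Pr_or p_ge0 p_le1 _ _) _; apply: lerD; first exact: Pr_not_dense.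
apply: le_trans (_ : Ex p Y / y <= _).
  apply: Ex_markov => // Z; by rewrite !addr_ge0 // mulr_ge0.
rewrite ler_pM2r ?invr_gt0 // /Y !ExD ExZ !lerD //.
- by rewrite ler_wpM2l // Ex_bad0.
- exact: Ex_bad1.
- exact: Ex_bad2.
- exact: Ex_bad3.
Qed.

End HubEstimates.

(** * Upper bound *)

(** Supplies the weights of [Pr_small_common]. Solving for the exponential of [- a] gives a positive
    value exactly because [b] is below the logarithm. *)
Lemma exists_tilt (R : realType) (p b : R) : 0 < p -> p < 1 ->
  0 <= b -> b < ln (1 / (1 - p)) ->
  exists2 a : R, 0 <= a & expR (- b) = 1 - p + p * expR (- a).
Proof.
move=> p0 p1 b0 bc.
have h1 : 1 - p < expR (- b) by rewrite -expRN_logb_base // ltr_expR ltrN2.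
have h2 : expR (- b) <= 1 by rewrite -[leRHS]expR0 ler_expR oppr_le0.
pose la := (expR (- b) - (1 - p)) / p.
have la0 : 0 < la by rewrite divr_gt0 // subr_gt0.
have la1 : la <= 1 by rewrite ler_pdivrMr //; lra.
exists (- ln la); first by rewrite oppr_ge0 ln_le0.
by rewrite opprK lnK ?posrE // /la mulrC divfK; [ring|lra].
Qed.

(** Here [L * c] is [ln n]. The cost [a * (dl * m)] is at most [th / 4] times [ln n], and the gain
    is at least [1 + th / 4] times [ln n]. *)
Lemma tilt_exponent_le (R : realType) (p c L th m a b dl C2 : R) : 0 < p -> 0 < c ->
  0 < L -> 0 < th -> th < 1 -> 0 <= a -> 0 < C2 -> 0 <= m -> m <= C2 * (L * c) ->
  (1 + th) * L / p <= m -> b = c * (1 + th / 4) / (1 + th / 2) ->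
  0 <= dl -> dl <= th / 4 / ((a + 1) * C2) ->
  a * (dl * m) - b * (p * m - th / 4 * (p * m)) <= - (L * c).
Proof.
move=> p0 c0 L0 th0 th1 a0 C20 m0 mC mL bE dl0 dlle.
have h1 : a * (dl * m) <= th / 4 * (L * c).
  apply: le_trans (_ : (a + 1) * (th / 4 / ((a + 1) * C2) * (C2 * (L * c))) <= _).
    apply: ler_pM => //; [by rewrite mulr_ge0|by lra|].
    by apply: ler_pM.
  rewrite le_eqVlt; apply/orP; left; apply/eqP; field.
  by rewrite !lt0r_neq0 //; lra.
have b0 : 0 < b.
  by rewrite bE divr_gt0 ?mulr_gt0 //; lra.
have h2 : (1 + th / 4) * (L * c) <= b * (p * m - th / 4 * (p * m)).
  have -> : (1 + th / 4) * (L * c) = b * ((1 + th / 2) * L).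
    by rewrite bE; field; rewrite lt0r_neq0 //; lra.
  rewrite ler_pM2l //.
  have h3 : (1 + th) * L <= p * m by rewrite [leRHS]mulrC -ler_pdivrMr.
  apply: le_trans (_ : (1 - th / 4) * ((1 + th) * L) <= _); last first.
    have -> : p * m - th / 4 * (p * m) = (1 - th / 4) * (p * m) by ring.
    by rewrite ler_wpM2l //; lra.
  rewrite mulrA ler_wpM2r ?(ltW L0) //; nra.
lra.
Qed.

(** Edges to first hubs take at most [n * ((1 + eps / 8) * L + 2)], exceptions [eps / 4], and the
    terms linear in [n] are absorbed because [L] is large. *)
Lemma upper_total_le (R : realType) (p eps n L m h tk : R) :
  0 < p -> p < 1 -> 0 < eps -> eps < 1 ->
  0 <= n -> 0 < L -> m <= (1 + eps / 16) * L / p + 1 -> h <= n -> 0 <= tk ->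
  2 * (3 + tk) / eps <= L ->
  h + n * (p * m + eps / 16 / 4 * (p * m)) + tk * n + eps / 4 * (n * L) <=
  (1 + eps) * (n * L).
Proof.
move=> p0 p1 e0 e1 n0 L0 mle hn tk0 tkL.
have tk' : 2 * (3 + tk) <= L * eps by rewrite -ler_pdivrMr.
have pm : p * m <= (1 + eps / 16) * L + p.
  have := ler_wpM2l (ltW p0) mle.
  by have -> : p * ((1 + eps / 16) * L / p + 1) = (1 + eps / 16) * L + p by field; lra.
have pm2 : p * m + eps / 16 / 4 * (p * m) <= (1 + eps / 8) * L + 2.
  have -> : p * m + eps / 16 / 4 * (p * m) = (1 + eps / 64) * (p * m) by field.
  apply: le_trans (_ : (1 + eps / 64) * ((1 + eps / 16) * L + p) <= _).
    by rewrite ler_wpM2l //; lra.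
  have q1 : (1 + eps / 64) * (1 + eps / 16) <= 1 + eps / 8 by nra.
  have q2 : (1 + eps / 64) * p <= 2 by nra.
  have := ler_wpM2r (ltW L0) q1; rewrite mulrDr mulrA; lra.
have l1 : n * (p * m + eps / 16 / 4 * (p * m)) <= n * ((1 + eps / 8) * L + 2).
  by rewrite ler_wpM2l.
have l2 : n * (2 * (3 + tk)) <= n * (L * eps) by rewrite ler_wpM2l.
have nL : 0 <= n * (L * eps) by rewrite !mulr_ge0 // ltW.
lra.
Qed.

(** The deviation is proportional to [m], so Chebyshev's bound is of order [1 / m] and cancels the
    logarithmic number of hubs. *)
Lemma upper_first_term_le (R : realType) (p c eps x h m C1 : R) :
  0 < p -> 0 < c -> 0 < eps ->
  0 < x -> 0 <= C1 -> h <= C1 * x -> x / c / p <= m ->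
  h * (m / (eps / 16 / 4 * (p * m)) ^+ 2) <= C1 * c / ((eps / 16 / 4) ^+ 2 * p).
Proof.
move=> p0 c0 e0 x0 C10 hC mx.
have m0 : 0 < m by apply: lt_le_trans mx; rewrite !divr_gt0.
have -> : m / (eps / 16 / 4 * (p * m)) ^+ 2 = ((eps / 16 / 4) ^+ 2 * p ^+ 2 * m)^-1.
  by field; rewrite !lt0r_neq0.
set q := eps / 16 / 4; have q0 : 0 < q by rewrite /q; lra.
rewrite ler_pdivrMr; last by rewrite !mulr_gt0 // exprn_gt0.
have -> : C1 * c / (q ^+ 2 * p) * (q ^+ 2 * p ^+ 2 * m) = C1 * (c * p * m).
  by field; rewrite !lt0r_neq0.
apply: le_trans hC _; rewrite ler_wpM2l //.
by move: mx; rewrite !ler_pdivrMr // => h'; rewrite mulrAC [c * m]mulrC mulrAC.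
Qed.

Lemma upper_prob_le (R : realType) (eps n L S C3 : R) : 0 < eps -> 0 < n -> 0 < L -> 0 <= C3 ->
  16 * (C3 + 2) / eps ^+ 2 <= L ->
  S <= n * (C3 + 2) + eps ^+ 2 / 32 * (n * L) ->
  S / (eps / 4 * (n * L)) <= eps / 2.
Proof.
move=> e0 n0 L0 C30 CL SS; have e20 : 0 < eps ^+ 2 by rewrite exprn_gt0.
have nL : 0 < n * L by rewrite mulr_gt0.
rewrite ler_pdivrMr; last by rewrite mulr_gt0 // divr_gt0.
have CL' : 16 * (C3 + 2) <= L * eps ^+ 2 by rewrite -ler_pdivrMr.
have := ler_wpM2l (ltW n0) CL'.
have : 0 <= eps ^+ 2 * (n * L) by rewrite mulr_ge0 // ltW.
have -> : eps / 2 * (eps / 4 * (n * L)) = eps ^+ 2 * (n * L) / 8 by field.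
by move=> l1 l2; lra.
Qed.

Lemma card_hub m M K t : #|hub m M K t| = (m + M * t + t * K * t)%N.
Proof. by rewrite !card_sum !card_prod !card_ord. Qed.

Lemma exists_hub_embedding m M K t n : (#|hub m M K t| <= n)%N ->
  exists enc : hub m M K t -> 'I_n, injective enc.
Proof.
move=> le_n; exists (fun h => widen_ord le_n (enum_rank h)).
by move=> h h' /(congr1 val) /= /val_inj /enum_rank_inj.
Qed.

Lemma sat_upper_whp (R : realType) (p eps : R) (s : nat) :
  0 < p -> p < 1 -> (3 <= s)%N -> 0 < eps -> eps < 1 ->
  exists N : nat, forall n, (N <= n)%N ->
    gnp_pr p (fun G : sgraph 'I_n => (1 + eps) * (n%:R * logb (1 / (1 - p)) n%:R) <
      (sat G (complete_graph s))%:R) <= eps.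
Proof.
move=> p0 p1; case: s => [//|[//|t]] t0 e0 e1; rewrite 2!ltnS in t0.
set c := ln (1 / (1 - p)); have c0 : 0 < c by apply: logb_base_gt0.
have tR : 0 < t%:R :> R by rewrite ltr0n.
pose th := eps / 16.
have th0 : 0 < th by rewrite /th; lra.
have th1 : th < 1 by rewrite /th; lra.
(* Below [c], so that a tilt exists, yet large enough for [p * m] near [(1 + th) * L] to gain more
   than [ln n]. *)
pose b := c * (1 + th / 4) / (1 + th / 2).
have b0 : 0 <= b by rewrite divr_ge0 ?mulr_ge0 ?(ltW c0) //; lra.
have bc : b < c.
  by rewrite /b ltr_pdivrMr; [rewrite ltr_pM2l //|]; lra.
have [a a0 abE] := exists_tilt p0 p1 b0 bc.
pose C2 := 2 / (p * c) + 1.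
have C20 : 0 < C2.
  by rewrite addr_gt0 // divr_gt0 // mulr_gt0.
(* Fraction of the first hubs that two vertices should share; small enough for the tilt cost, and at
   most 1 as the hypergraph requires. *)
pose dl := Num.min 1 (th / 4 / ((a + 1) * C2)).
have dlpos : 0 < th / 4 / ((a + 1) * C2).
  by rewrite !divr_gt0 // mulr_gt0 //; lra.
have dl01 : 0 < dl <= 1 by rewrite lt_min ltr01 dlpos ge_min lexx.
have dlle : dl <= th / 4 / ((a + 1) * C2) by rewrite ge_min lexx orbT.
have powp k : (0 < k)%N -> 0 < p ^+ k < 1.
  by move=> k0; rewrite exprn_gt0 // exprn_ilt1 // ?ltW // -lt0n.
(* The value 1/4 per hub leaves [2^-1 ^+ m] after the union bound over [2 ^+ m] sets. *)
have [cc ccP] : exists N : nat, (1 - p ^+ (t * t)) ^+ N <= 4^-1.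
  apply: exists_small_pow; last by rewrite invr_gt0.
  have tt0 : (0 < t * t)%N by rewrite muln_gt0 t0.
  have /andP[q0 q1] := powp _ tt0; lra.
have [m0 m0P] := exists_tri_free_hypergraph cc t0 dl01.
pose pi := p ^+ (t.+2 * t.+2).
have /andP[pi0 pi1] : 0 < pi < 1 by apply: powp.
(* With [M] at least [ln n / g], a given pair is missed by all second blocks with probability at
   most [1 / n]. *)
pose g := - ln (1 - pi).
have g0 : 0 < g by rewrite oppr_gt0 ln_lt0 //; lra.
have gE : 1 - pi = expR (- g) by rewrite opprK lnK // posrE; lra.
have ig0 : 0 < g^-1 + 1 by rewrite addr_gt0 // invr_gt0.
(* Chosen so that the expected size of [bad1] is at most [eps ^+ 2 / 32 * (n * L)]; hence [K] does
   not depend on [n]. *)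
pose ka := eps ^+ 2 / (32 * c * ((g^-1 + 1) * t%:R)).
have ka0 : 0 < ka by rewrite divr_gt0 ?exprn_gt0 // !mulr_gt0.
have [K KP] : exists N : nat, (1 - pi) ^+ N <= ka.
  by apply: exists_small_pow => //; lra.
have [m1 m1P] : exists N : nat, 2^-1 ^+ N <= eps / 2.
  by apply: exists_small_pow; lra.
pose C1 := C2 + (g^-1 + 1) * t%:R + (t * K * t)%:R.
have C10 : 0 <= C1.
  have gt0 : 0 <= (g^-1 + 1) * t%:R by rewrite mulr_ge0 // ltW.
  by rewrite /C1 addr_ge0 // addr_ge0 // ltW.
pose C3 := C1 * c / ((eps / 16 / 4) ^+ 2 * p).
have C30 : 0 <= C3.
  apply: divr_ge0; first by rewrite mulr_ge0 // ltW.
  by rewrite mulr_ge0 ?sqr_ge0 // ltW.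
have [X1 X1P] := @poly_le_expR R (C1 ^+ 2) 1 (sqr_ge0 _) ltr01.
pose L0 := Num.max (16 * (C3 + 2) / eps ^+ 2)
  (Num.max (2 * (3 + (t * K * t)%:R) / eps) (m0 + m1)%:R).
have [N NP] := ln_nat_ge (Num.max X1 (c * L0)).
exists N => n /NP [n0]; rewrite ge_max => /andP[/X1P [x1 hubn] xL].
rewrite /logb -/c; set x := ln n%:R in x1 hubn xL *; set L := x / c.
have {xL} : L0 <= L by rewrite /L ler_pdivlMr // mulrC.
rewrite !ge_max => /and3P[L1 L2 L3].
have nE : n%:R = expR x by rewrite expR_nat_ln.
have x0 : 0 < x by lra.
have Lpos : 0 < L by rewrite divr_gt0.
have nR : 0 < n%:R :> R by rewrite ltr0n.
have [m [mlo mhi]] : exists m : nat, (1 + th) * L / p <= m%:R /\ m%:R <= (1 + th) * L / p + 1.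
  have [k [k1 k2]] : exists k : nat, k%:R <= (1 + th) * L / p /\ (1 + th) * L / p < k.+1%:R.
    apply: exists_floor; apply: divr_ge0; last exact: ltW.
    by apply: mulr_ge0; [lra|apply: ltW].
  by exists k.+1; split; [apply: ltW|rewrite -natr1 lerD2r].
have [M [Mlo Mhi]] : exists M : nat, x / g <= M%:R /\ M%:R <= x / g + 1.
  have [k [k1 k2]] : exists k : nat, k%:R <= x / g /\ x / g < k.+1%:R.
    by apply: exists_floor; rewrite divr_ge0 // ltW.
  by exists k.+1; split; [apply: ltW|rewrite -natr1 lerD2r].
have Lm : L <= m%:R.
  apply: le_trans mlo; rewrite ler_pdivlMr //; nra.
have mm : (m0 + m1 <= m)%N by rewrite -(ler_nat R); apply: le_trans L3 Lm.
have [qs [vq qt qc]] := m0P m (leq_trans (leq_addr _ _) mm).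
have mC2 : m%:R <= C2 * x.
  apply: le_trans mhi _; rewrite /C2 [leRHS]mulrDl mul1r; apply: lerD => //.
  have -> : 2 / (p * c) * x = 2 * L / p by rewrite /L; field; rewrite !lt0r_neq0.
  by rewrite ler_pM2r ?invr_gt0 // ler_pM2r //; lra.
have MC : M%:R <= (g^-1 + 1) * x.
  by apply: le_trans Mhi _; rewrite mulrDl mul1r [g^-1 * x]mulrC lerD2l.
have hubC : #|hub m M K t|%:R <= C1 * x :> R.
  rewrite card_hub !natrD [(M * t)%:R]natrM /C1 [leRHS]mulrDl [X in _ <= X + _]mulrDl.
  apply: lerD; last by rewrite ler_peMr.
  by apply: lerD => //; rewrite mulrAC ler_pM2r.
have hub2 : (#|hub m M K t| * #|hub m M K t|)%:R <= n%:R :> R.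
  rewrite natrM nE; move: hubn; rewrite mul1r; apply: le_trans.
  apply: le_trans (_ : (C1 * x) ^+ 2 <= _).
    by rewrite expr2; apply: ler_pM.
  rewrite exprMn ler_wpM2l ?sqr_ge0 //.
  by apply: lerXn2r; rewrite ?nnegrE; lra.
have hubn' : (#|hub m M K t| <= n)%N.
  by rewrite ler_nat in hub2; apply: leq_trans hub2; case: #|_| => // k; rewrite leq_pmulr.
have [enc enc_inj] := exists_hub_embedding hubn'.
have mpos : 0 < m%:R :> R by apply: lt_le_trans Lm.
have d0 : 0 < eps / 16 / 4 * (p * m%:R).
  by apply: mulr_gt0; [rewrite !divr_gt0|rewrite mulr_gt0].
have y0 : 0 < eps / 4 * (n%:R * L).
  by apply: mulr_gt0; [rewrite divr_gt0|rewrite mulr_gt0].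
rewrite gnp_prE.
have := @Pr_sat_gt_hub R p (ltW p0) (ltW p1) 'I_n m M K t qs enc enc_inj
  (eps / 16 / 4 * (p * m%:R)) (dl * m%:R) a b ((1 + eps) * (n%:R * L))
  (eps / 4 * (n%:R * L)) (cc * m)%N t0 vq qt qc d0 a0 b0 abE y0.
rewrite card_ord => H; apply: le_trans (H _) _ => {H}.
  rewrite [(t * K * t * n)%:R]natrM.
  by apply: upper_total_le => //; rewrite ltW.
have E1 : 2 ^+ m * (1 - p ^+ (t * t)) ^+ (cc * m) <= eps / 2.
  rewrite exprM -exprMn.
  apply: le_trans (_ : 2^-1 ^+ m <= _).
    apply: lerXn2r; rewrite ?nnegrE ?invr_ge0 //.
      by rewrite mulr_ge0 // exprn_ge0 // subr_ge0 exprn_ile1 // ltW.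
    by lra.
  apply: le_trans m1P; apply: ler_wiXn2l; first by rewrite invr_ge0.
    by rewrite invf_le1 // ler1n.
  exact: leq_trans (leq_addl _ _) mm.
have T1 : #|hub m M K t|%:R * (n%:R * (m%:R / (eps / 16 / 4 * (p * m%:R)) ^+ 2)) <= n%:R * C3.
  rewrite mulrCA ler_pM2l //; apply: (@upper_first_term_le _ _ _ _ x _ _ _ p0 c0 e0) => //.
  apply: le_trans mlo; rewrite ler_pM2r ?invr_gt0 //.
  by apply: ler_peMl; [apply: ltW|lra].
have T2 : (M * t * n)%:R * (1 - pi) ^+ K <= eps ^+ 2 / 32 * (n%:R * L).
  apply: le_trans (_ : ((g^-1 + 1) * x * t%:R * n%:R) * ka <= _).
    apply: ler_pM => //; first by rewrite exprn_ge0 // subr_ge0 ltW.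
    by rewrite !natrM ler_pM2r // ler_pM2r.
  rewrite le_eqVlt; apply/orP; left; apply/eqP; rewrite /ka /L.
  by move: (g^-1 + 1) ig0 => ig ig0; field; rewrite !lt0r_neq0.
have expn : n%:R * n%:R * expR (- x) = n%:R.
  by rewrite -mulrA {2}nE -expRD subrr expR0 mulr1.
have T3 : (n * n)%:R * expR (a * (dl * m%:R) - b * (p * m%:R - eps / 16 / 4 * (p * m%:R))) <= n%:R.
  rewrite natrM -[leRHS]expn ler_wpM2l ?mulr_ge0 // ler_expR.
  have dl0 : 0 <= dl by case/andP: dl01 => /ltW.
  have xLc : x = L * c by rewrite /L divfK // lt0r_neq0.
  rewrite xLc; apply: (@tilt_exponent_le R p c L th _ _ _ _ C2) => //.
  by rewrite -xLc.
have T4 : (n * n)%:R * (1 - pi) ^+ M <= n%:R.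
  rewrite natrM -[leRHS]expn ler_wpM2l ?mulr_ge0 // gE -expRM_natl ler_expR mulrN lerN2.
  by rewrite -ler_pdivrMr.
(* One half for the failure of [dense_cliques], the other for too many exceptions. *)
rewrite [leRHS](_ : eps = eps / 2 + eps / 2); last by field.
apply: lerD => //; apply: (upper_prob_le e0 nR Lpos C30 L1).
rewrite -/pi; lra.
Qed.

(** * Convergence in probability *)

Lemma sat_whp (R : realType) (p e : R) (s : nat) :
  0 < p -> p < 1 -> (3 <= s)%N -> 0 < e -> e <= 1 ->
  exists N : nat, forall n, (N <= n)%N ->
    1 - e <= gnp_pr p (fun G : sgraph 'I_n =>
      `| (sat G (complete_graph s))%:R - n%:R * logb (1 / (1 - p)) n%:R |
        <= e * (n%:R * logb (1 / (1 - p)) n%:R)).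
Proof.
move=> p0 p1 s3 e0 e1.
(* A quarter suffices: the two tails add up to [e / 2], and [(1 - e / 4) ^+ 2] is at least
   [1 - e]. *)
have e40 : 0 < e / 4 by lra.
have e41 : e / 4 < 1 by lra.
have [N1 N1P] := sat_lower_whp p0 p1 s3 e40 e41.
have [N2 N2P] := sat_upper_whp p0 p1 s3 e40 e41.
have [N3 N3P] := ln_nat_ge (0 : R).
exists (N1 + N2 + N3)%N => n nN.
have low := N1P n (leq_trans (leq_trans (leq_addr _ _) (leq_addr _ _)) nN).
have upp := N2P n (leq_trans (leq_trans (leq_addl _ _) (leq_addr _ _)) nN).
have [_ ln0] := N3P n (leq_trans (leq_addl _ _) nN).
have nL0 : 0 <= n%:R * logb (1 / (1 - p)) n%:R :> R.
  by rewrite mulr_ge0 // divr_ge0 // ltW // logb_base_gt0.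
move: low upp nL0; rewrite !gnp_prE; move: (n%:R * _) => y low upp y0.
rewrite lerBlDr addrC -lerBlDr -(PrC p).
apply: le_trans (_ : e / 4 + e / 4 <= _); last by lra.
apply: le_trans (lerD low upp).
apply: le_trans (Pr_or (ltW p0) (ltW p1) _ _).
apply: le_Pr; rewrite ?ltW // => Z /=; move: (_%:R) => z.
apply: contraNT; rewrite negb_or -!leNgt => /andP[l u].
have ey : 0 <= e * y by rewrite mulr_ge0 // ltW.
rewrite ler_distl; apply/andP; split; last by lra.
apply: le_trans l.
have e2 : 0 <= e ^+ 2 * y by rewrite mulr_ge0 // sqr_ge0.
have -> : (1 - e / 4) ^+ 2 * y = y - e * y / 2 + e ^+ 2 * y / 16 by field.
lra.
Qed.

(* [delta n] is, up to [1/(n+1)], the least accuracy [e] that is reached with probability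
   at least [1 - e]. *)
Lemma exists_rate (R : realType) (P : nat -> R -> R) :
  (forall n e, P n e <= 1) -> (forall n, 0 <= P n 1) ->
  (forall n e e', e <= e' -> P n e <= P n e') ->
  (forall e, 0 < e -> e <= 1 -> exists N : nat, forall n, (N <= n)%N -> 1 - e <= P n e) ->
  exists delta : nat -> R,
    (delta n @[n --> \oo] --> (0 : R) /\ P n (delta n) @[n --> \oo] --> (1 : R))%classic.
Proof.
move=> P1 P0 Pmono Pev.
pose A n : classical_sets.set R := fun e => 0 < e /\ 1 - e <= P n e.
have Ainf n : has_inf (A n).
  split; first by exists 1; split => //; rewrite subrr.
  by exists 0 => e [/ltW].
pose delta n := inf (A n) + n.+1%:R^-1.
have inf0 n : 0 <= inf (A n).
  by apply: lb_le_inf; [case: (Ainf n)|move=> e [/ltW]].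
have n0 n : 0 < n.+1%:R^-1 :> R by rewrite invr_gt0.
have delta0 : (delta n @[n --> \oo] --> (0 : R))%classic.
  rewrite -[0]addr0; apply: cvgD; last exact: cvg_harmonic.
  apply/cvgr0Pnorm_le => e e0.
  pose e' := Num.min e 1.
  have e'0 : 0 < e' by rewrite lt_min e0 ltr01.
  have e'1 : e' <= 1 by rewrite ge_min lexx orbT.
  have [N NP] := Pev e' e'0 e'1; exists N => // n /= Nn.
  rewrite ger0_norm //; apply: le_trans (_ : e' <= _); last by rewrite ge_min lexx.
  by apply: ge_inf; [case: (Ainf n)|split => //; apply: NP].
exists delta; split => //.
(* The infimum need not be attained, but adding [1/(n+1)] puts a member of [A n] below [delta n],
   and monotonicity carries its bound over. *)
have lowP n : 1 - delta n <= P n (delta n).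
  have [e [e0 eP] ed] := inf_adherent (n0 n) (Ainf n).
  apply: le_trans (_ : 1 - e <= _); first by rewrite lerD2l lerN2 ltW.
  by apply: le_trans eP _; apply: Pmono; apply: ltW.
apply: (@squeeze_cvgr _ _ _ _ (fun n => 1 - delta n) (fun=> 1)).
- by apply: nearW => n; rewrite lowP P1.
- by rewrite -[X in (_ --> X)%classic]subr0; apply: cvgB => //; apply: cvg_cst.
- exact: cvg_cst.
Qed.

Local Open Scope classical_set_scope.

Theorem theorem1p1 (R : realType) (p : R) (s : nat) (p_gt0 : 0 < p) (p_lt1 : p < 1)
    (s_ge3 : (3 <= s)%N) :
  exists delta : nat -> R,
    delta n @[n --> \oo] --> (0 : R) /\
    gnp_pr p (fun G : sgraph 'I_n =>
        `| (sat G (complete_graph s))%:R - n%:R * logb (1 / (1 - p)) n%:R |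
          <= delta n * (n%:R * logb (1 / (1 - p)) n%:R))
      @[n --> \oo] --> (1 : R).
Proof.
apply: (@exists_rate R (fun n e => gnp_pr p (fun G : sgraph 'I_n =>
        `| (sat G (complete_graph s))%:R - n%:R * logb (1 / (1 - p)) n%:R |
          <= e * (n%:R * logb (1 / (1 - p)) n%:R)))).
- by move=> n e; rewrite gnp_prE Pr_le1 // ltW.
- by move=> n; rewrite gnp_prE /Pr Ex_ge0 // ltW.
- move=> n e e' ee'; rewrite !gnp_prE; apply: le_Pr; rewrite ?ltW // => Z h.
  apply: le_trans h _; apply: ler_wpM2r => //.
  (* Monotonicity in [e] needs a nonnegative right factor; for [n] equal to 0 it vanishes, and
     otherwise the logarithm of [n] is nonnegative. *)
  have [->|n0] := posnP n; first by rewrite mul0r.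
  apply: mulr_ge0 => //; apply: divr_ge0; first by rewrite ln_ge0 // ler1n.
  by apply: ltW; apply: logb_base_gt0.
- by move=> e e0 e1; apply: sat_whp.
Qed.
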